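(* Let $n,m$ be positive integers and let $k,l$ be integers with $0\le k,l\le\min\{n,m\}$. Then in the $A_2$ web space $$\langle S_{n,m}^{k,l}\rangle_3=\sum_{t=\max\{k,l\}}^{\min\{k+l,n,m\}}\frac{{n\brack t}{m\brack t}{t\brack k}{t\brack l}{n+m-t+2\brack n+m-k-l+2}}{{n\brack k}{m\brack k}{n\brack l}{m\brack l}}\ \langle R_{n,m}^{k,l}(t)\rangle_3 ,$$ where $S_{n,m}^{k,l}$ (the bubble skein element) and $R_{n,m}^{k,l}(t)$ are the clasped diagrams described in the context.
   Context: **Quantum notation.** $[k]=\frac{q^{k/2}-q^{-k/2}}{q^{1/2}-q^{-1/2}}$, $[k]!=\prod_{l=1}^k[l]$, ${n\brack k}=\frac{[n]!}{[k]![n-k]!}$ for $0\le k\le n$ and $0$ for $k>n$. **$A_2$ webs.** Let $D_\varepsilon$ be a disk with marked boundary points, each labelled $+$ or $-$. Consider oriented planar uni-trivalent graphs in $D_\varepsilon$ (vertexless closed loops are allowed) in which every trivalent vertex is a sink or a source, and whose univalent vertices are exactly the marked points, the adjacent edge pointing towards the point if its label is $+$ and away from it if its label is $-$. A basis web is such a graph, up to boundary-fixing isotopy, all of whose internal faces have at least six sides (no closed loops). The web space $W_\varepsilon$ is the $\mathbb{Q}(q^{1/6})$-vector space with basis the basis webs. The $A_2$ bracket $\langle\cdot\rangle_3$ sends linear combinations of such graphs to $W_\varepsilon$ and is determined by the local rules: a square face is replaced by the sum of the two ways of joining its four outer edges in neighbouring pairs without crossings; a bigon is replaced by $[2]$ times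 an edge; a closed loop is removed with factor $[3]$. (No crossings occur in this statement.) **Clasps.** Let $H$ be the web with two incoming ends on the left meeting at a trivalent sink, two outgoing ends on the right leaving a trivalent source, and an edge from the source to the sink. $P_n$ is a web with $n$ incoming points on the left and $n$ outgoing points on the right: $P_1$ is a single strand and $$P_n=(P_{n-1}\sqcup 1)-\frac{[n-1]}{[n]}(P_{n-1}\sqcup 1)\,(\mathrm{id}_{n-2}\sqcup H)\,(P_{n-1}\sqcup 1),$$ where $\sqcup 1$ adds one strand below, products are horizontal concatenation, and $H$ acts on the two lowest strands. $P_0$ is empty. Clasps are inserted in bundles of parallel strands with the matching orientation. **The diagrams.** Work in a rectangle with four groups of boundary points: NW with $n-k$ points (outgoing), SW with $m-k$ points (incoming), NE with $n-l$ points (incoming), SE with $m-l$ points (outgoing). In both diagrams clasps $P_{n-k},P_{m-k},P_{n-l},P_{m-l}$ are inserted at NW, SW, NE, SE respectively. - $S_{n,m}^{k,l}$: in the middle there is an upper clasp $P_n$, directed from right to left, and a lower clasp $P_m$, directed from left to right. On the left of the clasps, the upper $n-k$ ends of $P_n$ go to NW, the lower $m-k$ ends of $P_m$ come from SW, and the $k$ lower ends of $P_n$ are joined to the $k$ upper ends of $P_m$ by nested arcs (directed from the upper to the lower clasp). On the right, the upper $n-l$ ends of $P_n$ come from NE, the lower $m-l$ ends of $P_m$ go to SE, and the $l$ lower ends of $P_n$ are joined to the $l$ upper ends of $P_m$ by nested arcs (directed from the lower to the upper clasp). - $R_{n,m}^{k,l}(t)$: the $n-t$ uppermost strands at NE run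 straight to the $n-t$ uppermost at NW; the $m-t$ lowermost strands at SW run straight to the $m-t$ lowermost at SE; the remaining $t-k$ strands at SW are joined by nested arcs to the remaining $t-k$ strands at NW; the remaining $t-l$ strands at NE are joined by nested arcs to the remaining $t-l$ strands at SE. *)

(* Defs.v *)
From HB Require Import structures.
From mathcomp Require Import all_boot all_order all_algebra.
From mathcomp Require Import finmap monalg.
From mathcomp Require Import boolp.
From Stdlib Require Import Relation_Operators.

Set Implicit Arguments.
Unset Strict Implicit.
Unset Printing Implicit Defensive.

Import GRing.Theory.
Local Open Scope ring_scope.

(** Quantum integers in Q(q^(1/6)); the variable 'X stands for q^(1/6). *)

Definition K : fieldType := {fraction {poly rat}}.

Definition q_half : K := FracField.tofrac ('X : {poly rat}) ^+ 3.

Definition qint (k : nat) : K :=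
  (q_half ^+ k - q_half ^- k) / (q_half - q_half^-1).

Definition qfact (n : nat) : K := \prod_(1 <= l < n.+1) qint l.

Definition qbinom (n k : nat) : K :=
  if (k <= n)%N then qfact n / (qfact k * qfact (n - k)) else 0.

(** The disk is a rectangle with its marked points on the left and right sides,
    and a planar graph in it is put in general position with respect to the
    horizontal coordinate.  A vertical line then meets it in a word, listing
    the strands from top to bottom: [true] for a strand directed from left to
    right, [false] for one directed from right to left.  So a marked point on
    the left side has sign - when its letter is [true] and + when it is
    [false], and the other way round on the right side.  From left to right the
    word changes at finitely many events; an event [(x, i)] has exactly [i]
    strands above it.
      Birth d : a left-pointing turn, creating strands directed [d] and [~~ d]
      Death   : a right-pointing turn, joining two adjacent strands
      Fuse   : a trivalent vertex, two edges on its left and one on its right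
      Fork   : a trivalent vertex, one edge on its left and two on its right
    The direction constraints on [Fuse] and [Fork] say that the vertex is a
    sink or a source. *)

Definition word := seq bool.

Inductive shape := Birth of bool | Death | Fuse | Fork.

Definition shape_code (x : shape) : bool + option bool :=
  match x with
  | Birth d => inl d
  | Death => inr None
  | Fuse => inr (Some true)
  | Fork => inr (Some false)
  end.

Definition shape_decode (c : bool + option bool) : shape :=
  match c with
  | inl d => Birth d
  | inr None => Death
  | inr (Some true) => Fuse
  | inr (Some false) => Fork
  end.

Lemma shape_codeK : cancel shape_code shape_decode.
Proof. by case. Qed.

HB.instance Definition _ := Countable.copy shape (can_type shape_codeK).

Definition event : choiceType := (shape * nat)%type.

Definition arity_in (x : shape) : nat :=
  match x with Birth _ => 0 | Death => 2 | Fuse => 2 | Fork => 1 end.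

Definition arity_out (x : shape) : nat :=
  match x with Birth _ => 2 | Death => 0 | Fuse => 1 | Fork => 2 end.

Definition act (u : word) (e : event) : option word :=
  let: (x, i) := e in
  match x, drop i u with
  | Birth d, t =>
      if (i <= size u)%N then Some (take i u ++ [:: d, ~~ d & t]) else None
  | Death, a :: b :: t => if b == ~~ a then Some (take i u ++ t) else None
  | Fuse, a :: b :: t =>
      if b == a then Some (take i u ++ (~~ a) :: t) else None
  | Fork, a :: t => Some (take i u ++ [:: ~~ a, ~~ a & t])
  | _, _ => None
  end.

Fixpoint run (u : word) (d : seq event) : option word :=
  if d is e :: d' then obind (fun v => run v d') (act u e) else Some u.

Definition is_web (w w' : word) (d : seq event) : bool := run w d == Some w'.

Definition web (w w' : word) : choiceType := {d : seq event | is_web w w' d}.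

(** Boundary-fixing planar isotopy is generated by: exchanging two
    consecutive events that lie far apart, straightening a zigzag, and rotating
    a trivalent vertex by bending one of its edges around. *)

Inductive isotopy_move : seq event -> seq event -> Prop :=
| MoveExchange x y i j :
    isotopy_move [:: (x, i); (y, i + arity_out x + j)%N]
                 [:: (y, i + arity_in x + j)%N; (x, i)]
| MoveZigzag d i : isotopy_move [:: (Birth d, i); (Death, i.+1)] [::]
| MoveZagzig d i : isotopy_move [:: (Birth d, i.+1); (Death, i)] [::]
| MoveVertexBelow d i :
    isotopy_move [:: (Birth d, i.+1); (Fuse, i)] [:: (Fork, i)]
| MoveVertexAbove d i :
    isotopy_move [:: (Birth d, i); (Fuse, i.+1)] [:: (Fork, i)].

Inductive isotopy_step (w w' : word) : seq event -> seq event -> Prop :=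
| IsotopyStep p l r s u v of isotopy_move l r & is_web w u p & is_web u v l
    & is_web u v r & is_web v w' s :
    isotopy_step w w' (p ++ l ++ s) (p ++ r ++ s).

Definition isotopic (w w' : word) : seq event -> seq event -> Prop :=
  clos_refl_sym_trans _ (isotopy_step w w').

Section IsotopyClasses.
Variables w w' : word.

Definition isotopicb (x y : web w w') : bool :=
  `[< isotopic w w' (val x) (val y) >].

Lemma isotopicb_refl : reflexive isotopicb.
Proof. by move=> x; apply/asboolP; apply: rst_refl. Qed.

Lemma isotopicb_sym : symmetric isotopicb.
Proof.
by move=> x y; apply: asbool_equiv_eq; split=> h; apply: rst_sym.
Qed.

Lemma isotopicb_trans : transitive isotopicb.
Proof.
move=> y x z /asboolP hxy /asboolP hyz; apply/asboolP.
exact: rst_trans hxy hyz.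
Qed.

Canonical isotopicb_equiv :=
  EquivRel isotopicb isotopicb_refl isotopicb_sym isotopicb_trans.

Definition isotopy_class : Type := {eq_quot isotopicb}%qT.

HB.instance Definition _ := Choice.on isotopy_class.
HB.instance Definition _ := EqQuotient.on isotopy_class.

End IsotopyClasses.

(** Faces.  After [j] events the vertical line is cut by its strands into
    gaps; the gap below exactly [g] strands is the cell [(j, g)].  The event
    number [j] connects the cells of levels [j] and [j.+1]; the connected
    components are the faces.  The corners of a face, one for each time it
    passes a trivalent vertex, count its sides. *)

Section Faces.
Variables (w : word) (d : seq event).

Let cell : Type := (nat * nat)%type.

Definition level_size (j : nat) : nat := size (odflt [::] (run w (take j d))).

Definition is_cell (c : cell) : Prop :=
  (c.1 <= size d)%N /\ (c.2 <= level_size c.1)%N.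

Inductive next_cell : cell -> cell -> Prop :=
| NextAbove p x i s g of d = p ++ (x, i) :: s & (g <= i)%N :
    next_cell (size p, g) ((size p).+1, g)
| NextBelow p x i s g of d = p ++ (x, i) :: s
    & (i + arity_in x <= g)%N & (g <= level_size (size p))%N :
    next_cell (size p, g) ((size p).+1, g - arity_in x + arity_out x)%N.

Definition same_face : cell -> cell -> Prop := clos_refl_sym_trans _ next_cell.

Definition boundary_cell (c : cell) : Prop :=
  [\/ c.1 = 0, c.1 = size d, c.2 = 0 | c.2 = level_size c.1]%N.

Definition internal_face (c : cell) : Prop :=
  is_cell c /\ (forall c', same_face c c' -> ~ boundary_cell c').

Definition corners : seq cell :=
  flatten [seq match nth (Death, 0%N) d j with
               | (Fuse, i) => [:: (j, i); (j, i.+1); (j, i.+2)]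
               | (Fork, i) => [:: (j.+1, i); (j.+1, i.+1); (j.+1, i.+2)]
               | _ => [::]
               end | j <- iota 0 (size d)].

Definition sides (c : cell) : nat :=
  count (fun c' => `[< same_face c c' >]) corners.

(** This excludes closed loops, and all closed components: an innermost one
    is a loop bounding a face without corners, or, by Euler's formula, has at
    least two disk faces inside it with two or four sides. *)
Definition nonelliptic : Prop :=
  forall c, internal_face c -> (6 <= sides c)%N.

End Faces.

(** The web space: [nonelliptic] is invariant under isotopy, so it can be
    tested on the chosen representative of a class. *)

Definition basis_web (w w' : word) : choiceType :=
  {c : isotopy_class w w' | `[< nonelliptic w (val (repr c)) >]}.

Definition web_space (w w' : word) : lmodType K := {malg K[basis_web w w']}.

(** Linear combinations of event sequences: the free associative algebra on
    the events, whose product is horizontal concatenation.  Putting strands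
    below a diagram does not change its event sequence. *)

Definition diagrams := {malg K[{fmonom event}]}.

Definition diag (d : seq event) : diagrams := << FMonom d >>.

(** The bracket is the linear map satisfying these rules (Kuperberg: it exists,
    and it is unique on webs).  They constrain [br] only on the sequences that
    are webs from [w] to [w'], and [bubble] and [rung] below are combinations of
    such sequences. *)
Record is_A2_bracket (w w' : word)
    (br : {linear diagrams -> web_space w w'}) : Prop := {
  bracket_isotopy : forall d d',
    isotopy_step w w' d d' -> br (diag d) = br (diag d');
  bracket_basis : forall b : basis_web w w',
    br (diag (val (repr (val b)))) = << b >>;
  bracket_loop : forall u p s d i,
    is_web w u p -> is_web u w' s ->
    is_web u u [:: (Birth d, i); (Death, i)] ->
    br (diag (p ++ [:: (Birth d, i); (Death, i)] ++ s))
    = qint 3 *: br (diag (p ++ s));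
  bracket_bigon : forall u p s i,
    is_web w u p -> is_web u w' s ->
    is_web u u [:: (Fork, i); (Fuse, i)] ->
    br (diag (p ++ [:: (Fork, i); (Fuse, i)] ++ s))
    = qint 2 *: br (diag (p ++ s));
  (* two horizontal edges joined by two vertical rungs *)
  bracket_square : forall u p s d i,
    is_web w u p -> is_web u w' s ->
    is_web u u [:: (Fork, i); (Fuse, i.+1); (Fork, i); (Fuse, i.+1)] ->
    is_web u u [:: (Death, i); (Birth d, i)] ->
    br (diag (p ++ [:: (Fork, i); (Fuse, i.+1); (Fork, i); (Fuse, i.+1)]
                ++ s))
    = br (diag (p ++ s)) + br (diag (p ++ [:: (Death, i); (Birth d, i)] ++ s))
}.

(** The web H on the strands [i] and [i.+1]. *)
Definition Hweb (i : nat) : diagrams := diag [:: (Fuse, i); (Fork, i)].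

(** The clasp on [n] strands directed from left to right, with [i] strands
    above it. *)
Fixpoint clasp (i n : nat) : diagrams :=
  match n with
  | 0 => 1
  | n1.+1 =>
    if n1 is n2.+1 then
      clasp i n1
      - (qint n1 / qint n) *: (clasp i n1 * Hweb (i + n2)%N * clasp i n1)
    else 1
  end.

(** The same clasp rotated by a half turn, for strands directed from right to
    left: the recursion now adds the new strand above. *)
Fixpoint clasp_rot (i n : nat) : diagrams :=
  match n with
  | 0 => 1
  | n1.+1 =>
    if n1 is n2.+1 then
      clasp_rot i.+1 n1
      - (qint n1 / qint n) *: (clasp_rot i.+1 n1 * Hweb i * clasp_rot i.+1 n1)
    else 1
  end.

(** [k] nested arcs open to the right, inserted below [a] strands; and [k]
    nested arcs joining the strands [a-k .. a-1] to the strands [a .. a+k-1]. *)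
Definition arcs_open (a k : nat) : diagrams :=
  diag [seq (Birth false, (a + j)%N) | j <- iota 0 k].
Definition arcs_close (a k : nat) : diagrams :=
  diag [seq (Death, (a - j.+1)%N) | j <- iota 0 k].

(** [a] strands directed to the left above [b] strands directed to the right,
    as a word and with their clasps. *)
Definition two_bundles (a b : nat) : word := nseq a false ++ nseq b true.
Definition two_clasps (a b : nat) : diagrams := clasp_rot 0 a * clasp a b.

(** The bubble skein element S_{n,m}^{k,l}. *)
Definition bubble (n m k l : nat) : diagrams :=
  two_clasps (n - k) (m - k) * arcs_open (n - k) k *
  two_clasps n m *
  arcs_close n l * two_clasps (n - l) (m - l).

(** The diagram R_{n,m}^{k,l}(t). *)
Definition rung (n m k l t : nat) : diagrams :=
  two_clasps (n - k) (m - k) * arcs_close (n - k) (t - k) *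
  arcs_open (n - t) (t - l) * two_clasps (n - l) (m - l).

Definition bubble_coef (n m k l t : nat) : K :=
  qbinom n t * qbinom m t * qbinom t k * qbinom t l
    * qbinom (n + m - t + 2) (n + m - k - l + 2)
  / (qbinom n k * qbinom m k * qbinom n l * qbinom m l).

(* Main.v *)
(** Both clasps of the bubble are killed by every trivalent vertex that joins two
    of their strands: this follows from the Hecke-type relations [H_i^2 = [2] H_i]
    and [H_i H_j H_i - H_i = H_j H_i H_j - H_j] for adjacent [i], [j].  So a clasp
    is a projector, absorbs smaller clasps, and may be expanded by its recursion
    at either end.

    For [k = l = 1] expand both middle clasps by their recursion at the strand of
    the inner loop.  Of the four terms one is a loop, two are bigons and one is a
    square, and [[3][n][m] - [2][n-1][m] - [2][n][m-1] + [n-1][m-1] = [n+m+1]].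
    Closing more arcs on the right gives the case [k = 1] by induction on [l], and
    opening arcs one at a time on the left gives the general case by induction on
    [k].  Both inductions on the coefficients rest on the identity
    [[d+e][d+f] = [e][f] + [d][d+e+f]]. *)

From HB Require Import structures.
Require Import Defs.
From mathcomp Require Import all_boot all_order all_algebra.
From mathcomp Require Import finmap monalg zify ring.
From Stdlib Require Import Setoid Morphisms.
Set Implicit Arguments.
Unset Strict Implicit.
Unset Printing Implicit Defensive.
Import GRing.Theory.
Local Open Scope ring_scope.

(** * Words and events *)

(** The obstacle is that a local relation holds only where the strands have suitable directions,
    whereas products of event sequences forget directions and [br] is constrained on webs only. So
    [br] is replaced by its extension by zero, [webbr], and elements are compared by [cong_at u]:
    equal images after any sequence leading from [w] to [u] and before any element. Exchanges of
    distant events preserve even the failure of a run, hence hold at all words ([cong]); the other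
    relations need a condition on the word, and [homs] records how a left factor changes it. The
    computation is then setoid rewriting in an abstract algebra, with quantum integers known only
    through [0] = 0, [1] = 1, nonvanishing and the product identity.

    Each clasp is needed in two forms: the recursions in [two_clasps] strip the outermost strands,
    while the arcs of the bubble sit on the innermost ones. [gclasp] is shown to kill H on its
    right, [gclasp_rot] on its left; hence their product equals each of them, and all other
    absorption properties follow. *)

Lemma run_cat u d e : run u (d ++ e) = obind (fun v => run v e) (run u d).
Proof. by elim: d u => [|a d IH] u //=; case: (act u a) => //=. Qed.

#[local] Arguments act : simpl never.

Lemma act_cons a u x i : act (a :: u) (x, i.+1) = omap (cons a) (act u (x, i)).
Proof.
case: x => [d|||]; rewrite /act /=; first by rewrite ltnS; case: leqP.
all: by case: (drop i u) => [|b [|b' t]] //=; case: eqP.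
Qed.

Lemma act_cat v u x i :
  act (v ++ u) (x, size v + i)%N = omap (cat v) (act u (x, i)).
Proof.
elim: v => [|a v IH]; first by rewrite add0n; case: (act u _).
by rewrite act_cons IH; case: (act u _).
Qed.

Lemma act_short u x i : (size u < i + arity_in x)%N -> act u (x, i) = None.
Proof.
rewrite /act; case: x => [d|||] /= h.
- by rewrite addn0 in h; rewrite leqNgt h.
- have: (size (drop i u) < 2)%N by rewrite size_drop; lia.
  by case: (drop i u) => [|a [|b t]].
- have: (size (drop i u) < 2)%N by rewrite size_drop; lia.
  by case: (drop i u) => [|a [|b t]].
- have: (size (drop i u) < 1)%N by rewrite size_drop; lia.
  by case: (drop i u).
Qed.

Lemma act_local x v t : size v = arity_in x ->
  act (v ++ t) (x, 0%N) = omap (cat^~ t) (act v (x, 0%N)).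
Proof.
by rewrite /act; case: x v => [d|||] [|a [|b [|c v]]] //= _;
  rewrite ?take0 ?drop0 //; case: ifP.
Qed.

Lemma act_size x v o : size v = arity_in x -> act v (x, 0%N) = Some o ->
  size o = arity_out x.
Proof.
by rewrite /act; case: x v => [d|||] [|a [|b [|c v]]] //= _; rewrite ?take0;
  try case: ifP => // _; case=> <-.
Qed.

(** The word is cut into the strands above [x], those consumed by [x], and the rest, on which [y]
    acts. Being an equality in [option], it includes failing runs; this is what makes [exchange]
    valid at every word. *)
Lemma run_exchange u x y i j :
  run u [:: (x, i); (y, i + arity_out x + j)%N]
  = run u [:: (y, i + arity_in x + j)%N; (x, i)].
Proof.
case: (leqP (i + arity_in x) (size u)) => [h|h]; last first.
  by rewrite /= !act_short //; lia.
pose p := take i u; pose v := take (arity_in x) (drop i u).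
have sp : size p = i by rewrite size_takel //; lia.
have sv : size v = arity_in x by rewrite size_takel // size_drop; lia.
rewrite -(cat_take_drop i u) -/p -(cat_take_drop (arity_in x) (drop i u)) -/v.
move: (drop _ (drop _ _)) => t.
have act_x s : act (p ++ v ++ s) (x, i) = omap (fun o => p ++ o ++ s) (act v
  (x, 0%N)).
  by rewrite -{1}[i]addn0 -sp act_cat act_local //; case: (act v _).
have act_y q s : size q = s -> act (p ++ q ++ t) (y, i + s + j)%N
    = omap (fun o => p ++ q ++ o) (act t (y, j)).
  move=> <-; rewrite catA -sp -size_cat act_cat; case: (act t _) => //= o.
  by rewrite catA.
rewrite [run]lock -!lock /= act_x (act_y v) //.
case ho: (act v _) => [o|] /=; last by case: (act t _) => //= o;
  rewrite act_x ho.
rewrite (act_y o) ?(act_size sv ho) //.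
by case: (act t _) => //= o'; rewrite act_x ho.
Qed.

Lemma act_cat0 v t x : act (v ++ t) (x, size v) = omap (cat v) (act t (x, 0%N)).
Proof. by rewrite -[size v]addn0 act_cat. Qed.

Lemma act_cat1 v t x : act (v ++ t) (x, (size v).+1) = omap (cat v) (act t (x,
  1%N)).
Proof. by rewrite -addn1 act_cat. Qed.

Lemma act_cat2 v t x : act (v ++ t) (x, (size v).+2) = omap (cat v) (act t (x,
  2%N)).
Proof. by rewrite -addn2 act_cat. Qed.

Lemma act_cat3 v t x : act (v ++ t) (x, (size v).+3) = omap (cat v) (act t (x,
  3%N)).
Proof. by rewrite -addn3 act_cat. Qed.

Lemma act_birth d t : act t (Birth d, 0%N) = Some [:: d, ~~ d & t].
Proof. by rewrite /act take0 drop0. Qed.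

Lemma act_death a t : act [:: a, ~~ a & t] (Death, 0%N) = Some t.
Proof. by rewrite /act /= eqxx. Qed.

Lemma act_death' a t : act [:: ~~ a, a & t] (Death, 0%N) = Some t.
Proof. by rewrite /act /= negbK eqxx. Qed.

Lemma act_fuse a t : act [:: a, a & t] (Fuse, 0%N) = Some (~~ a :: t).
Proof. by rewrite /act /= eqxx. Qed.

Lemma act_fork a t : act (a :: t) (Fork, 0%N) = Some [:: ~~ a, ~~ a & t].
Proof. by []. Qed.

Definition actE := (act_cat0, act_cat1, act_cat2, act_cat3, act_cons, act_birth,
  act_death, act_death', act_fuse, act_fork, cat_cons, cat0s, negbK).

Ltac run_tac := do ?[progress rewrite /= ?actE]; try done.

Definition reads (s : word) (u : word) (i : nat) : bool := prefix s (drop i u).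

(** Nonemptiness of [s] forces [i] to lie inside [u]: beyond the end [drop] returns the empty word,
    and [i] would not be the length of a prefix. *)
Lemma readsP s u i : reads s u i -> (0 < size s)%N ->
  exists v t, u = v ++ s ++ t /\ i = size v.
Proof.
move=> /prefixP [t e] ss; exists (take i u), t;
  rewrite -e cat_take_drop size_takel //.
by case: (leqP i (size u)) => // /ltnW h; move: ss e; rewrite drop_oversize //;
  case: s.
Qed.

Lemma reads_cat s v t i : reads s (v ++ t) (size v + i)%N = reads s t i.
Proof. by rewrite /reads addnC -drop_drop drop_size_cat. Qed.

Lemma reads_cat0 s v t : reads s (v ++ t) (size v) = reads s t 0.
Proof. by rewrite -[size v]addn0 reads_cat. Qed.

Lemma reads_cat1 s v t : reads s (v ++ t) (size v).+1 = reads s t 1.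
Proof. by rewrite -addn1 reads_cat. Qed.

Lemma reads_cat2 s v t : reads s (v ++ t) (size v).+2 = reads s t 2.
Proof. by rewrite -addn2 reads_cat. Qed.

Definition readsE := (reads_cat0, reads_cat1, reads_cat2).

Ltac reads_tac := rewrite ?readsE /reads /= ?drop0 ?prefix_cons ?negbK ?eqxx
  ?prefix0s //.


(** * Congruence of diagrams *)

Section Skein.

Variables (F : fieldType) (A : algType F) (dg : seq event -> A).
Hypothesis dg_nil : dg [::] = 1.
Hypothesis dg_cat : forall d e, dg (d ++ e) = dg d * dg e.
Hypothesis dg_ind : forall P : A -> Prop,
  P 0 -> (forall x y, P x -> P y -> P (x + y)) ->
  (forall c x, P x -> P (c *: x)) -> (forall d, P (dg d)) -> forall x, P x.

Variables (W : lmodType F) (w w' : word) (phi : {linear A -> W}).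
(* The bracket is constrained on webs only; taking it to vanish elsewhere makes
   [cong_at] below compatible with multiplication by arbitrary elements. *)
Hypothesis phi_nonweb : forall d, run w d <> Some w' -> phi (dg d) = 0.

(** The morphisms from [u] to [v] in the linear category of webs, given by closure rules so that
    linear extension becomes induction. *)
Inductive homs (u v : word) : A -> Prop :=
| HomDg d of run u d = Some v : homs u v (dg d)
| HomZero : homs u v 0
| HomAdd x y of homs u v x & homs u v y : homs u v (x + y)
| HomScale c x of homs u v x : homs u v (c *: x).

Lemma homs1 u : homs u u 1.
Proof. by rewrite -dg_nil; apply: HomDg. Qed.

Lemma homsM u v z x y : homs u v x -> homs v z y -> homs u z (x * y).
Proof.
move=> hx hy; elim: hx => {x} [d hd||x x' _ IH _ IH'|c x _ IH].
- elim: hy => {y} [e he||y y' _ IH _ IH'|c y _ IH].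
  + by rewrite -dg_cat; apply: HomDg; rewrite run_cat hd /= he.
  + by rewrite mulr0; apply: HomZero.
  + by rewrite mulrDr; apply: HomAdd.
  + by rewrite -scalerAr; apply: HomScale.
- by rewrite mul0r; apply: HomZero.
- by rewrite mulrDl; apply: HomAdd.
- by rewrite -scalerAl; apply: HomScale.
Qed.

(* [x] and [y] agree wherever the strands on their left spell [u]; which word they
   lead to plays no role, since [act] is a function. *)
Definition cong_at (u : word) (x y : A) : Prop :=
  forall p z, run w p = Some u -> phi (dg p * x * z) = phi (dg p * y * z).

Definition cong (x y : A) : Prop := forall u, cong_at u x y.

#[local] Instance cong_at_equiv u : Equivalence (cong_at u).
Proof.
split=> [x p z //|x y h p z hp|x y t h1 h2 p z hp]; first by rewrite h.
by rewrite h1 // h2.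
Qed.

#[local] Instance cong_equiv : Equivalence cong.
Proof.
split=> [x u p z //|x y h u p z hp|x y t h1 h2 u p z hp].
  by rewrite (h u).
by rewrite (h1 u) // (h2 u).
Qed.

#[local] Instance cong_sub u : subrelation cong (cong_at u).
Proof. by move=> x y h; apply: h. Qed.

#[local] Instance cong_atD u :
  Proper (cong_at u ==> cong_at u ==> cong_at u) +%R.
Proof.
by move=> x x' hx y y' hy p z hp; rewrite !mulrDr !mulrDl !linearD /= hx ?hy.
Qed.

#[local] Instance cong_atZ u c : Proper (cong_at u ==> cong_at u) ( *:%R c).
Proof.
by move=> x x' hx p z hp; rewrite -!scalerAr -!scalerAl !linearZ /= hx.
Qed.

#[local] Instance cong_atN u : Proper (cong_at u ==> cong_at u) -%R.
Proof. by move=> x x' hx; rewrite -!scaleN1r; apply: cong_atZ. Qed.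

#[local] Instance cong_at_mulr u : Proper (cong_at u ==> eq ==> cong_at u) *%R.
Proof. by move=> x x' hx y _ <- p z hp; rewrite !mulrA -!(mulrA _ y) hx. Qed.

Lemma cong_at_mull u v a x y :
  homs u v a -> cong_at v x y -> cong_at u (a * x) (a * y).
Proof.
move=> ha hxy; elim: ha => {a} [d hd||a b _ IHa _ IHb|c a _ IH].
- move=> p z hp; rewrite !mulrA -!dg_cat; apply: hxy.
  by rewrite run_cat hp.
- by rewrite !mul0r; reflexivity.
- by rewrite !mulrDl; apply: cong_atD.
- by rewrite -!scalerAl; apply: cong_atZ.
Qed.

(** By linearity the right factor is a single sequence [s]. If [s] does not complete [d] to a web,
    it does not complete [e] either, and both images are 0. *)
Lemma cong_at_dg u d e :
  (forall s, run u (d ++ s) = run u (e ++ s)) ->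
  (forall p s, run w p = Some u -> run u (d ++ s) = Some w' ->
     phi (dg (p ++ d ++ s)) = phi (dg (p ++ e ++ s))) ->
  cong_at u (dg d) (dg e).
Proof.
move=> hde h p z hp; elim/dg_ind: z => [|x y hx hy|c x hx|s].
- by rewrite !mulr0.
- by rewrite !mulrDr !linearD /= hx hy.
- by rewrite -!scalerAr !linearZ /= hx.
rewrite -!dg_cat -!catA.
case: (run u (d ++ s) =P Some w') => [hs|hs]; first exact: h.
by rewrite !phi_nonweb // run_cat hp //= -hde.
Qed.

Lemma cong_at_nonweb u d : run u d = None -> cong_at u (dg d) 0.
Proof.
move=> hd p z hp; rewrite mulr0 mul0r linear0 -dg_cat.
elim/dg_ind: z => [|x y hx hy|c x hx|e].
- by rewrite mulr0 linear0.
- by rewrite mulrDr linearD /= hx hy addr0.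
- by rewrite -scalerAr linearZ /= hx scaler0.
- by rewrite -dg_cat phi_nonweb // !run_cat hp /= hd.
Qed.

(** The left factor is decomposed into sequences [d]. If [d] runs from [u] to some [v], the
    congruence of the right factors at [v] applies; if it fails, both products are congruent to 0
    because [phi] vanishes off webs. *)
#[local] Instance congM : Proper (cong ==> cong ==> cong) *%R.
Proof.
move=> x x' hx y y' hy u; transitivity (x * y').
  elim/dg_ind: x {x' hx} => [|a b ha hb|c a ha|d].
  - by rewrite !mul0r; reflexivity.
  - by rewrite !mulrDl ha hb; reflexivity.
  - by rewrite -!scalerAl ha; reflexivity.
  - case hd: (run u d) => [v|].
      by apply: cong_at_mull (hy v); apply: HomDg.
    by rewrite (cong_at_nonweb hd) !mul0r; reflexivity.
by rewrite (hx u); reflexivity.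
Qed.

#[local] Instance congD : Proper (cong ==> cong ==> cong) +%R.
Proof. by move=> x x' hx y y' hy u; rewrite (hx u) (hy u); reflexivity. Qed.

#[local] Instance congZ c : Proper (cong ==> cong) ( *:%R c).
Proof. by move=> x x' hx u; rewrite (hx u); reflexivity. Qed.

Hypothesis phi_move : forall u v p l r s, isotopy_move l r ->
  run w p = Some u -> run u l = Some v -> run u r = Some v ->
  run v s = Some w' -> phi (dg (p ++ l ++ s)) = phi (dg (p ++ r ++ s)).

Lemma cong_move u l r : isotopy_move l r -> run u l = run u r ->
  cong_at u (dg l) (dg r).
Proof.
move=> m e; apply: cong_at_dg => [s|p s hp]; first by rewrite !run_cat e.
rewrite run_cat; case hl: (run u l) => [v|] //= hs.
by apply: (phi_move m hp hl _ hs); rewrite -e.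
Qed.

Definition ev (x : Defs.shape) (i : nat) : A := dg [:: (x, i)].

Lemma dg2 x i y j : dg [:: (x, i); (y, j)] = ev x i * ev y j.
Proof. exact: (dg_cat [:: (x, i)]). Qed.

Lemma exchange x y i j :
  cong (ev x i * ev y (i + arity_out x + j)%N) (ev y (i + arity_in x
    + j)%N * ev x i).
Proof.
by move=> u; rewrite -!dg2; apply: cong_move;
  [apply: MoveExchange|apply: run_exchange].
Qed.
(** * Local relations *)

Lemma homs_ev u v x i : act u (x, i) = Some v -> homs u v (ev x i).
Proof. by move=> h; apply: HomDg; rewrite /= h. Qed.

Lemma exchange_eq x y i j k l : k = (i + arity_out x + j)%N ->
  l = (i + arity_in x + j)%N ->
  cong (ev x i * ev y k) (ev y l * ev x i).
Proof. by move=> -> ->; apply: exchange. Qed.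

Lemma zigzag d u i : reads [:: d] u i ->
  cong_at u (ev (Birth d) i * ev Death i.+1) 1.
Proof.
move=> /readsP [//|v [t [-> ->]]]; rewrite -dg2 -dg_nil.
by apply: cong_move; [apply: MoveZigzag|run_tac].
Qed.

Lemma zagzig d u i : reads [:: ~~ d] u i ->
  cong_at u (ev (Birth d) i.+1 * ev Death i) 1.
Proof.
move=> /readsP [//|v [t [-> ->]]]; rewrite -dg2 -dg_nil.
by apply: cong_move; [apply: MoveZagzig|run_tac].
Qed.

Lemma vertex_below d u i : reads [:: d] u i ->
  cong_at u (ev (Birth d) i.+1 * ev Fuse i) (ev Fork i).
Proof.
move=> /readsP [//|v [t [-> ->]]]; rewrite -dg2.
by apply: cong_move; [apply: MoveVertexBelow|run_tac].
Qed.

Lemma vertex_above d u i : reads [:: ~~ d] u i ->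
  cong_at u (ev (Birth d) i * ev Fuse i.+1) (ev Fork i).
Proof.
move=> /readsP [//|v [t [-> ->]]]; rewrite -dg2.
by apply: cong_move; [apply: MoveVertexAbove|run_tac].
Qed.

Lemma cong_mid u v x l r y :
  homs u v x -> cong_at v l r -> cong_at u (x * l * y) (x * r * y).
Proof. by move=> hx h; apply: cong_at_mulr => //; apply: cong_at_mull hx h. Qed.

(** The fork is opened into a birth followed by a fuse; the death then slides before the fuse and
    cancels the birth as a zigzag. *)
Lemma fork_death a u i : reads [:: a; a] u i ->
  cong_at u (ev Fork i * ev Death i.+1) (ev Fuse i).
Proof.
move=> /readsP [//|v [t [-> ->]]].
rewrite -(@vertex_below a _ (size v)); last by reads_tac.
rewrite -mulrA (@exchange_eq Fuse Death _ 0 _ (size v).+2) /=; try lia.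
rewrite mulrA zigzag ?mul1r; first by reflexivity.
by reads_tac.
Qed.

Lemma fork_death' a u i : reads [:: a; a] u i ->
  cong_at u (ev Fork i.+1 * ev Death i) (ev Fuse i).
Proof.
move=> /readsP [//|v [t [-> ->]]].
rewrite -(@vertex_above (~~ a) _ (size v).+1); last by reads_tac.
rewrite -mulrA -(@exchange_eq Death Fuse _ 0 (size v)) /=; try lia.
rewrite mulrA zagzig ?mul1r; first by reflexivity.
by reads_tac.
Qed.

(** Both sides are one rung between antiparallel strands: a birth whose two legs fuse with the
    strands above and below. Only the order of the two fuses differs. *)
Lemma ladder_eq a u i : reads [:: a; ~~ a] u i ->
  cong_at u (ev Fork i * ev Fuse i.+1) (ev Fork i.+1 * ev Fuse i).
Proof.
move=> /readsP [//|v [t [-> ->]]].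
rewrite -(@vertex_below a _ (size v)); last by reads_tac.
rewrite -mulrA (@exchange_eq Fuse Fuse _ 0 _ (size v).+2) /=; try lia.
rewrite mulrA vertex_above; first by reflexivity.
by reads_tac.
Qed.

(** Two readings of the tripod with three legs on the left. Each fuse is rewritten as the same fork
    of the middle strand followed by a death, and the two deaths are exchanged. *)
Lemma fuse_death a u i : reads [:: a; a; a] u i ->
  cong_at u (ev Fuse i * ev Death i) (ev Fuse i.+1 * ev Death i).
Proof.
move=> /readsP [//|v [t [-> ->]]].
rewrite -(@fork_death' a _ (size v)); last by reads_tac.
rewrite -(@fork_death a _ (size v).+1); last by reads_tac.
rewrite -!mulrA -(@exchange_eq Death Death (size v) 0 (size v)) /=; try lia.
by reflexivity.
Qed.

Lemma birth_fork d u i : (i <= size u)%N ->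
  cong_at u (ev (Birth d) i * ev Fork i) (ev (Birth (~~ d)) i * ev Fork i.+1).
Proof.
move=> hi; have [v [t [-> ->]]] : exists v t, u = v ++ t /\ i = size v.
  by exists (take i u), (drop i u); rewrite cat_take_drop size_takel.
have hB b : homs (v ++ t) (v ++ [:: b, ~~ b & t]) (ev (Birth b) (size v)).
  by apply: homs_ev; run_tac.
transitivity (ev (Birth d) (size v) * (ev (Birth (~~ d)) (size v) * ev Fuse
  (size v).+1)).
  apply: cong_at_mull (hB d) _; symmetry; apply: vertex_above; by reads_tac.
transitivity (ev (Birth (~~ d)) (size v) * (ev (Birth d) (size v).+2 * ev Fuse
  (size v).+1)).
  rewrite !mulrA (@exchange_eq (Birth (~~ d)) (Birth d) _ 0 _ (size v)) /=;
    try lia.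
  by reflexivity.
by apply: cong_at_mull (hB (~~ d)) _; apply: vertex_below; reads_tac.
Qed.

(** * Face relations, the Hecke-type relations, and partial closures of H *)

Variable qn : nat -> F.
Hypothesis phi_loop : forall u p s d (i : nat),
  run w p = Some u -> run u s = Some w' ->
  run u [:: (Birth d, i); (Death, i)] = Some u ->
  phi (dg (p ++ [:: (Birth d, i); (Death, i)] ++ s)) = qn 3
    *: phi (dg (p ++ s)).
Hypothesis phi_bigon : forall u p s (i : nat),
  run w p = Some u -> run u s = Some w' ->
  run u [:: (Fork, i); (Fuse, i)] = Some u ->
  phi (dg (p ++ [:: (Fork, i); (Fuse, i)] ++ s)) = qn 2 *: phi (dg (p ++ s)).
Hypothesis phi_square : forall u p s d i,
  run w p = Some u -> run u s = Some w' ->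
  run u [:: (Fork, i); (Fuse, i.+1); (Fork, i); (Fuse, i.+1)] = Some u ->
  run u [:: (Death, i); (Birth d, i)] = Some u ->
  phi (dg (p ++ [:: (Fork, i); (Fuse, i.+1); (Fork, i); (Fuse, i.+1)] ++ s))
  = phi (dg (p ++ s)) + phi (dg (p ++ [:: (Death, i); (Birth d, i)] ++ s)).

Lemma cong_at_intro u x y :
  (forall p s, run w p = Some u -> phi (dg p * x * dg s)
    = phi (dg p * y * dg s)) ->
  cong_at u x y.
Proof.
move=> h p z hp; elim/dg_ind: z => [|a b ha hb|c a ha|s]; last exact: h.
- by rewrite !mulr0.
- by rewrite !mulrDr !linearD /= ha hb.
- by rewrite -!scalerAr !linearZ /= ha.
Qed.

Lemma phi_nonweb_mid u p d s : run w p = Some u -> run u d = Some u ->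
  run u s <> Some w' -> phi (dg (p ++ d ++ s)) = 0.
Proof. by move=> hp hd hs; rewrite phi_nonweb // !run_cat hp /= run_cat hd. Qed.

Lemma loop d u i : (i <= size u)%N ->
  cong_at u (ev (Birth d) i * ev Death i) (qn 3 *: 1).
Proof.
move=> hi; rewrite -dg2; apply: cong_at_intro => p s hp.
have hu : run u [:: (Birth d, i); (Death, i)] = Some u.
  have [v [t [-> ->]]] : exists v t, u = v ++ t /\ i = size v.
    by exists (take i u), (drop i u); rewrite cat_take_drop size_takel.
  by run_tac.
rewrite -scalerAr mulr1 -scalerAl linearZ /= -!dg_cat -catA.
case: (run u s =P Some w') => hs; first exact: phi_loop hp hs hu.
by rewrite (phi_nonweb_mid hp hu hs) (phi_nonweb_mid (d :=
  [::]) hp _ hs) ?scaler0.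
Qed.

Lemma bigon a u i : reads [:: a] u i ->
  cong_at u (ev Fork i * ev Fuse i) (qn 2 *: 1).
Proof.
move=> hi; rewrite -dg2; apply: cong_at_intro => p s hp.
have hu : run u [:: (Fork, i); (Fuse, i)] = Some u.
  by have [//|v [t [-> ->]]] := readsP hi; run_tac.
rewrite -scalerAr mulr1 -scalerAl linearZ /= -!dg_cat -catA.
case: (run u s =P Some w') => hs; first exact: phi_bigon hp hs hu.
by rewrite (phi_nonweb_mid hp hu hs) (phi_nonweb_mid (d :=
  [::]) hp _ hs) ?scaler0.
Qed.

Lemma square d u i : reads [:: d; ~~ d] u i ->
  cong_at u (ev Fork i * ev Fuse i.+1 * (ev Fork i * ev Fuse i.+1))
            (1 + ev Death i * ev (Birth d) i).
Proof.
move=> hi; rewrite -!dg2 -dg_cat; apply: cong_at_intro => p s hp.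
have hu : run u [:: (Fork, i); (Fuse, i.+1); (Fork, i); (Fuse, i.+1)] = Some u.
  by have [//|v [t [-> ->]]] := readsP hi; run_tac.
have hu' : run u [:: (Death, i); (Birth d, i)] = Some u.
  by have [//|v [t [-> ->]]] := readsP hi; run_tac.
rewrite mulrDr mulrDl mulr1 linearD /= -!dg_cat -!catA.
case: (run u s =P Some w') => hs; first exact: phi_square hp hs hu hu'.
by rewrite (phi_nonweb_mid hp hu hs) (phi_nonweb_mid hp hu' hs)
  (phi_nonweb_mid (d := [::]) hp _ hs) ?addr0.
Qed.

Definition hw (i : nat) : A := dg [:: (Fuse, i); (Fork, i)].

Lemma hwE i : hw i = ev Fuse i * ev Fork i.
Proof. exact: dg2. Qed.

Lemma homs_hw a u i : reads [:: a; a] u i -> homs u u (hw i).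
Proof. by move=> /readsP [//|v [t [-> ->]]]; apply: HomDg; run_tac. Qed.

Lemma hw_sq a u i : reads [:: a; a] u i ->
  cong_at u (hw i * hw i) (qn 2 *: hw i).
Proof.
move=> /readsP [//|v [t [-> ->]]]; rewrite hwE mulrA -(mulrA (ev Fuse _)).
have -> : qn 2 *: (ev Fuse (size v) * ev Fork (size v))
  = ev Fuse (size v) * (qn 2 *: 1) * ev Fork (size v).
  by rewrite -scalerAr mulr1 scalerAl.
apply: (@cong_mid _ (v ++ ~~ a :: t)); first by apply: homs_ev; run_tac.
by apply: (@bigon (~~ a)); reads_tac.
Qed.

(** The web H turned by a quarter, a rung slanted one way here and the other way in [ladder'];
    having both forms lets a square be recognized in either product of H's in [hw_braid]. *)
Definition ladder i : A := ev Fork i * ev Fuse i.+1.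
Definition ladder' i : A := ev Fork i.+1 * ev Fuse i.

Lemma homs_ladder d u i : reads [:: d; ~~ d] u i ->
  exists2 u', reads [:: ~~ d; d] u' i & homs u u' (ladder i).
Proof.
move=> /readsP [//|v [t [-> ->]]]; exists (v ++ [:: ~~ d, d & t]);
  first by reads_tac.
by rewrite /ladder -dg2; apply: HomDg; run_tac.
Qed.

Lemma square1 d u i : reads [:: d; ~~ d] u i ->
  cong_at u (ladder i * ladder' i) (1 + ev Death i * ev (Birth d) i).
Proof.
move=> hi; rewrite -(square hi); have [u' hu' h] := homs_ladder hi.
by apply: cong_at_mull h _; symmetry; apply: (@ladder_eq (~~ d)); rewrite negbK.
Qed.

Lemma square2 d u i : reads [:: d; ~~ d] u i ->
  cong_at u (ladder' i * ladder i) (1 + ev Death i * ev (Birth d) i).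
Proof.
by move=> hi; rewrite -(square hi) /ladder' -(ladder_eq hi); reflexivity.
Qed.

(** Each triple product contains one square. Opening it leaves a single H, which the subtraction
    removes, and a pair of facing tripods on three strands; by [fuse_death] and [birth_fork] this
    pair is the same on both sides. *)
Lemma hw_braid a u i : reads [:: a; a; a] u i ->
  cong_at u (hw i * hw i.+1 * hw i - hw i) (hw i.+1 * hw i * hw i.+1 - hw i.+1).
Proof.
move=> /readsP [//|v [t [-> ->]]].
set u' := _ ++ _; pose i' := size v.
pose E1 := ev Fuse i' * ev Death i' * (ev (Birth (~~ a)) i' * ev Fork i').
pose E2 := ev Fuse i'.+1 * ev Death i' * (ev (Birth a) i' * ev Fork i'.+1).
have h0 : homs u' (v ++ [:: ~~ a, a & t]) (ev Fuse i').
  by apply: homs_ev; run_tac.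
have h1 : homs u' (v ++ [:: a, ~~ a & t]) (ev Fuse i'.+1).
  by apply: homs_ev; run_tac.
have H1 : cong_at u' (hw i' * hw i'.+1 * hw i') (hw i' + E1).
  have -> : hw i' * hw i'.+1 * hw i' = ev Fuse i' * (ladder i' * ladder' i') *
    ev Fork i'.
    by rewrite !hwE /ladder /ladder' !mulrA.
  have -> : hw i' + E1 = ev Fuse i' * (1 + ev Death i' * ev (Birth (~~ a)) i')
    * ev Fork i'.
    by rewrite hwE /E1 mulrDr mulr1 mulrDl !mulrA.
  by apply: (cong_mid _ h0); apply: square1; reads_tac.
have H2 : cong_at u' (hw i'.+1 * hw i' * hw i'.+1) (hw i'.+1 + E2).
  have -> : hw i'.+1 * hw i' * hw i'.+1 = ev Fuse i'.+1 * (ladder' i' * ladder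
    i') * ev Fork i'.+1.
    by rewrite !hwE /ladder /ladder' !mulrA.
  have -> : hw i'.+1 + E2 = ev Fuse i'.+1 * (1
    + ev Death i' * ev (Birth a) i') * ev Fork i'.+1.
    by rewrite hwE /E2 mulrDr mulr1 mulrDl !mulrA.
  by apply: (cong_mid _ h1); apply: square2; reads_tac.
rewrite H1 H2 [hw _ + _]addrC addrK [hw _ + _]addrC addrK.
rewrite /E1 (@fuse_death a); last by reads_tac.
have h2 : homs u' (v ++ t) (ev Fuse i'.+1 * ev Death i').
  by rewrite -dg2; apply: HomDg; run_tac.
apply: cong_at_mull h2 _; rewrite birth_fork ?negbK; first by reflexivity.
by rewrite size_cat leq_addr.
Qed.

(** Closing one strand of H leaves a bigon: the birth and the fuse form a fork, the fork and the
    death form a fuse. *)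
Lemma bubble_below d u i : reads [:: ~~ d] u i ->
  cong_at u (ev (Birth d) i * hw i.+1 * ev Death i) (qn 2 *: 1).
Proof.
move=> hi; have [//|v [t [eu ei]]] := readsP hi; subst u i.
rewrite hwE mulrA vertex_above // -mulrA.
rewrite -(@bigon (~~ d) _ (size v)) //.
have h : homs (v ++ [:: ~~ d] ++ t) (v ++ [:: d, d & t]) (ev Fork (size v)).
  by apply: homs_ev; run_tac.
by apply: cong_at_mull h _; apply: (@fork_death' d); reads_tac.
Qed.

Lemma bubble_above d u i : reads [:: d] u i ->
  cong_at u (ev (Birth d) i.+1 * hw i * ev Death i.+1) (qn 2 *: 1).
Proof.
move=> hi; have [//|v [t [eu ei]]] := readsP hi; subst u i.
rewrite hwE mulrA vertex_below // -mulrA.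
rewrite -(@bigon d _ (size v)) //.
have h : homs (v ++ [:: d] ++ t) (v ++ [:: ~~ d, ~~ d & t]) (ev Fork (size v)).
  by apply: homs_ev; run_tac.
by apply: cong_at_mull h _; apply: (@fork_death (~~ d)); reads_tac.
Qed.

(** The loop between two H's becomes a face with four corners, hence a square. *)
Lemma bubble_both d u i : reads [:: d; ~~ d] u i ->
  cong_at u (ev (Birth d) i.+1 * (hw i * hw i.+2) * ev Death i.+1)
            (1 + ev Death i * ev (Birth d) i).
Proof.
move=> hi; have [//|v [t [eu ei]]] := readsP hi; subst u i.
have [u' hu' h] := homs_ladder hi.
transitivity (ladder (size v) * (ev Fork (size v) * (ev Fork (size v).+2 * ev
  Death (size v).+1))).
  rewrite !hwE -!(mulrA (ev Fuse _)) (mulrA (ev Fork (size v))).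
  rewrite (@exchange_eq Fork Fuse _ 0 _ (size v).+1) /= ?addn0; try lia.
  rewrite !mulrA vertex_below; last by reads_tac.
  by rewrite /ladder; reflexivity.
rewrite -(square hi) -/(ladder (size v)); apply: cong_at_mull h _.
have [//|v' [t' [eu ei]]] := readsP hu'; rewrite ei {}eu.
have h' : homs (v' ++ [:: ~~ d; d] ++ t') (v' ++ [:: d, d,
  d & t']) (ev Fork (size v')).
  by apply: homs_ev; run_tac.
by apply: cong_at_mull h' _; apply: (@fork_death' d); reads_tac.
Qed.

(** * Clasps *)

Hypotheses (qn0 : qn 0 = 0) (qn1 : qn 1 = 1) (qn_neq0 : forall n, qn n.+1 != 0).
Hypothesis qnJ : forall d e f,
  qn (d + e)%N * qn (d + f)%N = qn e * qn f + qn d * qn (d + e + f)%N.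

Lemma qnD m n : qn (m + n).+1 = qn m.+1 * qn n.+1 - qn m * qn n.
Proof. by have := qnJ 1 m n; rewrite !add1n => ->;
  rewrite qn1 mul1r addrC addKr. Qed.

Fixpoint gclasp (i n : nat) : A :=
  match n with
  | 0 => 1
  | n1.+1 =>
    if n1 is n2.+1 then
      gclasp i n1
      - (qn n1 / qn n) *: (gclasp i n1 * hw (i + n2)%N * gclasp i n1)
    else 1
  end.

Fixpoint gclasp_rot (i n : nat) : A :=
  match n with
  | 0 => 1
  | n1.+1 =>
    if n1 is n2.+1 then
      gclasp_rot i.+1 n1
      - (qn n1 / qn n) *: (gclasp_rot i.+1 n1 * hw i * gclasp_rot i.+1 n1)
    else 1
  end.

Lemma gclaspSS i n : gclasp i n.+2 = gclasp i n.+1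
  - (qn n.+1 / qn n.+2) *: (gclasp i n.+1 * hw (i + n)%N * gclasp i n.+1).
Proof. by []. Qed.

Lemma gclasp_rotSS i n : gclasp_rot i n.+2 = gclasp_rot i.+1 n.+1
  - (qn n.+1 / qn n.+2) *: (gclasp_rot i.+1 n.+1 * hw i * gclasp_rot i.+1 n.+1).
Proof. by []. Qed.

(* [x] and [y] are the same polynomial in the webs H of two blocks of [n]
   parallel strands, the first with [i] strands above it, the second with [k]. *)
Inductive twin (i k n : nat) : A -> A -> Prop :=
| Twin1 : twin i k n 1 1
| TwinH j of (j.+1 < n)%N : twin i k n (hw (i + j)%N) (hw (k + j)%N)
| TwinM x x' y y' of twin i k n x x' & twin i k n y y' :
    twin i k n (x * y) (x' * y')
| TwinD x x' y y' of twin i k n x x' & twin i k n y y' :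
    twin i k n (x + y) (x' + y')
| TwinZ c x x' of twin i k n x x' : twin i k n (c *: x) (c *: x').

Lemma twin_recl i k m n x x' : twin i k m x x' -> (m <= n)%N -> twin i k n x x'.
Proof.
move=> h mn; elim: h => {x x'}; [exact: Twin1| |by move=> *;
  apply: TwinM|by move=> *; apply: TwinD|by move=> *; apply: TwinZ].
by move=> j hj; apply: TwinH; apply: leq_trans mn.
Qed.

Lemma twin_recr i k n x x' : twin i.+1 k.+1 n x x' -> twin i k n.+1 x x'.
Proof.
elim=> {x x'}; [exact: Twin1| |by move=> *; apply: TwinM|by move=> *;
  apply: TwinD|by move=> *; apply: TwinZ].
by move=> j hj; rewrite !addSnnS; apply: TwinH.
Qed.

Lemma twinB i k n x x' y y' : twin i k n x x' -> twin i k n y y' ->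
  twin i k n (x - y) (x' - y').
Proof. by move=> h h'; rewrite -(scaleN1r y) -(scaleN1r y');
  apply: TwinD => //; apply: TwinZ. Qed.

Lemma twin_clasp i k n : twin i k n (gclasp i n) (gclasp k n).
Proof.
elim: n => [|[|n] IH]; [exact: Twin1|exact: Twin1|rewrite !gclaspSS].
have h := twin_recl IH (leqnSn _).
by apply: (twinB h); apply: TwinZ; apply: (TwinM _ h); apply: (TwinM h);
  apply: TwinH.
Qed.

Lemma twin_clasp_rot i k n : twin i k n (gclasp_rot i n) (gclasp_rot k n).
Proof.
elim: n i k => [|[|n] IH] i k; [exact: Twin1|exact: Twin1|rewrite
  !gclasp_rotSS].
have h := twin_recr (IH i.+1 k.+1).
apply: (twinB h); apply: TwinZ; apply: (TwinM _ h); apply: (TwinM h).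
by have := @TwinH i k n.+2 0; rewrite !addn0; apply.
Qed.

Lemma reads_sub d u m n i j : reads (nseq n d) u i -> (i <= j)%N ->
  (j + m <= i + n)%N -> reads (nseq m d) u j.
Proof.
move=> /prefixP [t e] ij jm; rewrite /reads -(subnK ij) -drop_drop e.
have -> : n = ((j - i) + (m + (n - (j - i) - m)))%N by lia.
rewrite nseqD -catA drop_size_cat ?size_nseq // nseqD -catA.
by apply/prefixP; eexists.
Qed.

Lemma twin_homs d u i k n x x' : twin i k n x x' -> reads (nseq n d) u i ->
  homs u u x.
Proof.
move=> h hu; elim: h => {x x'}.
- exact: homs1.
- by move=> j hj; apply: (@homs_hw d); apply: (@reads_sub d _ 2 n i) => //; lia.
- by move=> *; apply: homsM; eassumption.
- by move=> *; apply: HomAdd.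
- by move=> *; apply: HomScale.
Qed.

(** An event above a block of strands only changes the number of strands over it, so it passes
    through the block by exchanges and shifts its position from the [arity_in] to the [arity_out]
    count. *)
Lemma twin_above y i n m c c' : twin (m + arity_out y + i) (m + arity_in y
  + i) n c c' ->
  cong (ev y m * c) (c' * ev y m).
Proof.
elim=> {c c'}.
- by rewrite mulr1 mul1r; reflexivity.
- move=> j _; rewrite !hwE mulrA (@exchange_eq y Fuse m (i + j) _ (m
  + arity_in y + i + j)%N); try lia.
  rewrite -mulrA (@exchange_eq y Fork m (i + j) _ (m + arity_in y + i + j)%N);
    try lia.
  by rewrite mulrA; reflexivity.
- by move=> a a' b b' _ ha _ hb; rewrite mulrA ha -mulrA hb mulrA; reflexivity.
- by move=> a a' b b' _ ha _ hb; rewrite mulrDr mulrDl ha hb; reflexivity.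
- by move=> z a a' _ ha; rewrite -scalerAr -scalerAl ha; reflexivity.
Qed.

Lemma twin_below y i k n m c c' : twin i k n c c' -> (i + n <= m)%N ->
  cong (c * ev y m) (ev y m * c).
Proof.
move=> h im; elim: h => {c c'}.
- by rewrite mulr1 mul1r; reflexivity.
- move=> j hj; rewrite !hwE.
  rewrite -mulrA (@exchange_eq Fork y _ (m - (i + j + 2)) _ (m.-1)) /=; try lia.
  rewrite mulrA (@exchange_eq Fuse y _ (m - (i + j + 2)) _ m) /=; try lia.
  by rewrite -mulrA; reflexivity.
- by move=> a a' b b' _ ha _ hb; rewrite -mulrA hb mulrA ha mulrA; reflexivity.
- by move=> a a' b b' _ ha _ hb; rewrite mulrDr mulrDl ha hb; reflexivity.
- by move=> z a a' _ ha; rewrite -scalerAr -scalerAl ha; reflexivity.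
Qed.

Lemma twin_hw i k n m c c' : twin i k n c c' -> (i + n <= m)%N ->
  cong (c * hw m) (hw m * c).
Proof.
move=> h im; rewrite hwE mulrA (twin_below _ h im) -mulrA (twin_below _ h im).
by rewrite mulrA; reflexivity.
Qed.

Lemma twin_comm i k n j l m c c' e e' : twin i k n c c' -> twin j l m e e' ->
  (i + n <= j)%N -> cong (c * e) (e * c).
Proof.
move=> hc he ij; elim: he => {e e'}.
- by rewrite mulr1 mul1r; reflexivity.
- by move=> a _; apply: twin_hw hc _; lia.
- by move=> a a' b b' _ ha _ hb; rewrite mulrA ha -mulrA hb mulrA; reflexivity.
- by move=> a a' b b' _ ha _ hb; rewrite mulrDr mulrDl ha hb; reflexivity.
- by move=> z a a' _ ha; rewrite -scalerAr -scalerAl ha; reflexivity.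
Qed.

(** A class, so that instance search can justify rewriting with [cong_at u] to the right of a factor
    [x] that preserves [u]. *)
Class endo (u : word) (x : A) : Prop := endoP : homs u u x.

#[local] Instance endo_mull u x : endo u x ->
  Proper (cong_at u ==> cong_at u) ( *%R x).
Proof. by move=> hx y z; apply: cong_at_mull hx. Qed.

#[local] Instance endoM u x y : endo u x -> endo u y -> endo u (x * y).
Proof. exact: homsM. Qed.

Lemma clasp_endo d u i n : reads (nseq n d) u i -> endo u (gclasp i n).
Proof. exact: (twin_homs (twin_clasp i i n)). Qed.

Lemma clasp_rot_endo d u i n : reads (nseq n d) u i -> endo u (gclasp_rot i n).
Proof. exact: (twin_homs (twin_clasp_rot i i n)). Qed.

Lemma hw_endo d n u i j : reads (nseq n d) u i -> (i <= j)%N ->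
  (j.+1 < i + n)%N ->
  endo u (hw j).
Proof.
by move=> h ij jn; apply: (@homs_hw d); apply: (@reads_sub d _ 2 n i) => //;
  lia.
Qed.

(** A clasp is 1 plus terms containing some H; once [x] has absorbed the smaller clasp, the
    correction term meets [x * hw _], which is 0. *)
Lemma clasp_absorbr u x i n :
  (forall j, (i <= j)%N -> (j.+1 < i + n)%N -> cong_at u (x * hw j) 0) ->
  cong_at u (x * gclasp i n) x.
Proof.
elim: n => [|[|n] IH] hx; first by rewrite mulr1; reflexivity.
  by rewrite mulr1; reflexivity.
have {}IH : cong_at u (x * gclasp i n.+1) x.
  by apply: IH => j h h'; apply: hx => //; lia.
rewrite gclaspSS mulrBr -scalerAr !mulrA IH hx ?mul0r ?scaler0 ?subr0; try lia.
by reflexivity.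
Qed.

Lemma clasp_rot_absorbr u x i n :
  (forall j, (i <= j)%N -> (j.+1 < i + n)%N -> cong_at u (x * hw j) 0) ->
  cong_at u (x * gclasp_rot i n) x.
Proof.
elim: n i => [|[|n] IH] i hx; first by rewrite mulr1; reflexivity.
  by rewrite mulr1; reflexivity.
have {}IH : cong_at u (x * gclasp_rot i.+1 n.+1) x.
  by apply: IH => j h h'; apply: hx => //; lia.
rewrite gclasp_rotSS mulrBr -scalerAr !mulrA IH hx ?mul0r ?scaler0 ?subr0;
  try lia.
by reflexivity.
Qed.

Lemma clasp_absorbl d u x i n : reads (nseq n d) u i ->
  (forall j, (i <= j)%N -> (j.+1 < i + n)%N -> cong_at u (hw j * x) 0) ->
  cong_at u (gclasp i n * x) x.
Proof.
elim: n => [|[|n] IH] hu hx; first by rewrite mul1r; reflexivity.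
  by rewrite mul1r; reflexivity.
have hu' : reads (nseq n.+1 d) u i by apply: (reads_sub hu) => //; lia.
have {}IH : cong_at u (gclasp i n.+1 * x) x.
  by apply: IH => // j h h'; apply: hx => //; lia.
have eP : endo u (gclasp i n.+1) by apply: clasp_endo hu'.
have eH : endo u (hw (i + n)) by apply: (hw_endo hu); lia.
rewrite gclaspSS mulrBl -scalerAl -!mulrA IH hx ?mulr0 ?scaler0 ?subr0; try lia.
by reflexivity.
Qed.

Lemma clasp_rot_absorbl d u x i n : reads (nseq n d) u i ->
  (forall j, (i <= j)%N -> (j.+1 < i + n)%N -> cong_at u (hw j * x) 0) ->
  cong_at u (gclasp_rot i n * x) x.
Proof.
elim: n i => [|[|n] IH] i hu hx; first by rewrite mul1r; reflexivity.
  by rewrite mul1r; reflexivity.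
have hu' : reads (nseq n.+1 d) u i.+1 by apply: (reads_sub hu) => //; lia.
have {}IH : cong_at u (gclasp_rot i.+1 n.+1 * x) x.
  by apply: IH => // j h h'; apply: hx => //; lia.
have eP : endo u (gclasp_rot i.+1 n.+1) by apply: clasp_rot_endo hu'.
have eH : endo u (hw i) by apply: (hw_endo hu); lia.
rewrite gclasp_rotSS mulrBl -scalerAl -!mulrA IH hx ?mulr0 ?scaler0 ?subr0;
  try lia.
by reflexivity.
Qed.

Lemma qnSS n : qn n.+2 = qn 2 * qn n.+1 - qn n.
Proof. by rewrite -[n.+1]/(1 + n)%N qnD qn1 mul1r. Qed.

Lemma jw_coef n (x y : A) (u : word) :
  cong_at u y ((qn n.+2 / qn n.+1) *: x) ->
    cong_at u (x - (qn n.+1 / qn n.+2) *: y) 0.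
Proof.
move=> ->; rewrite scalerA mulrA divfK ?qn_neq0 // divff ?qn_neq0 // scale1r
  subrr.
by reflexivity.
Qed.

(** An inner H is already killed by the smaller clasp. For the last one, h, with P the clasp on n+1
    strands, the claim is P h P h = ([n+2]/[n+1]) P h. Expanding the second P gives [2] P h minus
    ([n]/[n+1]) P h, and [n+2] = [2][n+1] - [n]. *)
Lemma clasp_hw d u i n j : reads (nseq n d) u i -> (i <= j)%N ->
  (j.+1 < i + n)%N ->
  cong_at u (gclasp i n * hw j) 0.
Proof.
elim: n j => [|[|n] IH] j hu ij jn; try lia.
have hu' : reads (nseq n.+1 d) u i by apply: (reads_sub hu) => //; lia.
have eP : endo u (gclasp i n.+1) by apply: clasp_endo hu'.
have eH : endo u (hw (i + n)) by apply: (hw_endo hu); lia.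
have eQ : endo u (gclasp i n).
  by apply: clasp_endo; apply: (@reads_sub d _ n n.+1 i _ hu'); lia.
rewrite gclaspSS mulrBl -scalerAl.
case: (ltnP j (i + n)) => [jn'|nj].
  have IHj : cong_at u (gclasp i n.+1 * hw j) 0 by apply: IH => //; lia.
  by rewrite -!mulrA IHj !mulr0 scaler0 subr0; reflexivity.
have -> : j = (i + n)%N by lia.
apply: jw_coef.
have hsq : cong_at u (hw (i + n) * hw (i + n)) (qn 2 *: hw (i + n)%N).
  by apply: (@hw_sq d); apply: (@reads_sub d _ 2 n.+2 i) => //; lia.
have hQ := twin_hw (twin_clasp i i n) (leqnn _).
have PQ : cong_at u (gclasp i n.+1 * gclasp i n) (gclasp i n.+1).
  by apply: clasp_absorbr => k h h'; apply: IH => //; lia.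
case: n IH hu jn hu' eP eH eQ hsq hQ PQ nj => [|n] IH hu jn hu' eP eH eQ hsq hQ
  PQ nj.
  by rewrite !mul1r mulr1 hsq qn1 divr1; reflexivity.
set P := gclasp i n.+2 in IH eP PQ *; set Q := gclasp i n.+1 in hQ eQ PQ *.
set h := hw (i + n.+1)%N in eH hsq hQ *; pose g := hw (i + n).
have eG : endo u g by apply: (hw_endo hu); lia.
have Pg : cong_at u (P * g) 0 by apply: IH => //; lia.
have PhQ : cong_at u (P * h * Q) (P * h).
  by rewrite -mulrA -(hQ u) mulrA PQ; reflexivity.
have br1 : cong_at u (h * g * h) (h + (g * h * g - g)).
  have hb : cong_at u (g * h * g - g) (h * g * h - h).
    rewrite /g /h addnS; apply: (@hw_braid d).
    by apply: (@reads_sub d _ 3 n.+3 i) => //; lia.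
  by rewrite hb addrC subrK; reflexivity.
have PhPh : cong_at u (P * h * P * h) (P * h * Q * h - (qn n.+1 / qn n.+2)
  *: (P * h * Q * g * Q * h)).
  by rewrite {2}/P gclaspSS -/Q mulrBr mulrBl -scalerAr -scalerAl !mulrA;
    reflexivity.
clearbody P Q h g.
rewrite PhPh PhQ -(mulrA P h h) hsq.
(* The braid relation trades [h * g * h] for [h + g * h * g - g]; the terms starting with [g] die
   against [P]. *)
have Phgh : cong_at u (P * (h * (g * (h * Q)))) (P * h).
  have -> : P * (h * (g * (h * Q))) = P * (h * g * h) * Q by rewrite !mulrA.
  rewrite br1 mulrDr mulrDl mulrBr mulrBl !mulrA Pg !mul0r subr0 addr0 PhQ.
  by reflexivity.
rewrite -!mulrA (hQ u) Phgh -scalerAr -scalerBl (qnSS n.+1).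
by rewrite mulrBl mulfK ?qn_neq0 //; reflexivity.
Qed.

(** The half turn of [clasp_hw]: left and right are exchanged together with above and below. *)
Lemma hw_clasp_rot d u i n j : reads (nseq n d) u i -> (i <= j)%N ->
  (j.+1 < i + n)%N ->
  cong_at u (hw j * gclasp_rot i n) 0.
Proof.
elim: n i j => [|[|n] IH] i j hu ij jn; try lia.
have hu' : reads (nseq n.+1 d) u i.+1 by apply: (reads_sub hu) => //; lia.
have eP : endo u (gclasp_rot i.+1 n.+1) by apply: clasp_rot_endo hu'.
have eH : endo u (hw i) by apply: (hw_endo hu); lia.
have eJ : endo u (hw j) by apply: (hw_endo hu); lia.
rewrite gclasp_rotSS mulrBr -scalerAr.
case: (ltnP i j) => [nj|nj].
  have IHj : cong_at u (hw j * gclasp_rot i.+1 n.+1) 0 by apply: IH => //; lia.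
  by rewrite !mulrA IHj !mul0r scaler0 subr0; reflexivity.
have -> : j = i by lia.
apply: jw_coef.
have hsq : cong_at u (hw i * hw i) (qn 2 *: hw i).
  by apply: (@hw_sq d); apply: (@reads_sub d _ 2 n.+2 i) => //; lia.
case: n IH hu jn hu' eP => [|n] IH hu jn hu' eP.
  by rewrite !mul1r !mulr1 hsq qn1 divr1; reflexivity.
set P := gclasp_rot i.+1 n.+2 in eP *; pose Q := gclasp_rot i.+2 n.+1.
have hu'' : reads (nseq n.+1 d) u i.+2 by apply: (reads_sub hu) => //; lia.
have eQ : endo u Q by apply: clasp_rot_endo hu''.
have QP : cong_at u (Q * P) P.
  by apply: (clasp_rot_absorbl hu'') => k h h'; apply: IH => //; lia.
have hQ : cong (hw i * Q) (Q * hw i).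
  have tH : twin i i 2 (hw i) (hw i) by have := @TwinH i i 2 0; rewrite addn0;
    apply.
  by apply: twin_comm tH (twin_clasp_rot i.+2 i.+2 n.+1) _; lia.
set h := hw i in eH hsq hQ *; pose g := hw i.+1.
have eG : endo u g by apply: (hw_endo hu); lia.
have gP : cong_at u (g * P) 0 by apply: IH => //; lia.
have QhP : cong_at u (Q * (h * P)) (h * P).
  by rewrite mulrA -(hQ u) -mulrA QP; reflexivity.
have br1 : cong_at u (h * g * h) (h + (g * h * g - g)).
  have hb : cong_at u (h * g * h - h) (g * h * g - g).
    apply: (@hw_braid d).
    by apply: (@reads_sub d _ 3 n.+3 i) => //; lia.
  by rewrite -hb addrC subrK; reflexivity.
have defP : P = Q - (qn n.+1 / qn n.+2) *: (Q * g * Q) by exact: gclasp_rotSS.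
clearbody P Q h g.
have hPhP : cong_at u (h * (P * h * P))
    (h * (Q * (h * P)) - (qn n.+1 / qn n.+2)
      *: (h * (Q * (g * (Q * (h * P)))))).
  rewrite {1}defP !mulrBl !mulrBr -!scalerAl -!scalerAr -!mulrA.
  by reflexivity.
have hghP : cong_at u (h * (Q * (g * (h * P)))) (h * P).
  have -> : h * (Q * (g * (h * P))) = h * Q * (g * (h * P)) by rewrite mulrA.
  rewrite (hQ u); have -> : Q * h * (g * (h * P))
    = Q * (h * g * h * P) by rewrite !mulrA.
  rewrite br1 mulrDl mulrBl -!mulrA gP !mulr0 subr0 addr0 QhP.
  by reflexivity.
rewrite hPhP QhP hghP (mulrA h h) hsq -scalerAl -scalerBl (qnSS n.+1).
by rewrite mulrBl mulfK ?qn_neq0 //; reflexivity.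
Qed.

(** The product [gclasp * gclasp_rot] equals its left factor, which kills H on the right, and its
    right factor, which kills H on the left. *)
Lemma clasp_rotE d u i n : reads (nseq n d) u i ->
  cong_at u (gclasp_rot i n) (gclasp i n).
Proof.
move=> hu; transitivity (gclasp i n * gclasp_rot i n).
  by symmetry; apply: (clasp_absorbl hu) => j h h'; apply: hw_clasp_rot hu _ _.
by apply: clasp_rot_absorbr => j h h'; apply: clasp_hw hu _ _.
Qed.

Lemma hw_clasp d u i n j : reads (nseq n d) u i -> (i <= j)%N ->
  (j.+1 < i + n)%N ->
  cong_at u (hw j * gclasp i n) 0.
Proof.
move=> hu ij jn; have eJ : endo u (hw j) by apply: (hw_endo hu).
by rewrite -(clasp_rotE hu); apply: hw_clasp_rot hu _ _.
Qed.

(** The recursion without case distinction: at [n = 0] the coefficient [0]/[1] removes the term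
    whose position [n.-1] is meaningless. *)
Lemma gclaspS i n : gclasp i n.+1 = gclasp i n
  - (qn n / qn n.+1) *: (gclasp i n * hw (i + n.-1)%N * gclasp i n).
Proof. by case: n => [|n] //=; rewrite qn0 mul0r scale0r subr0. Qed.

Lemma gclasp_rotS i n : gclasp_rot i n.+1 = gclasp_rot i.+1 n
  - (qn n / qn n.+1) *: (gclasp_rot i.+1 n * hw i * gclasp_rot i.+1 n).
Proof. by case: n => [|n] //=; rewrite qn0 mul0r scale0r subr0. Qed.

(* Locked, as unification would otherwise see a product in [gclasps a b] when
   rewriting with [mulrA]. *)
Definition gclasps (a b : nat) : A := locked (gclasp_rot 0 a * gclasp a b).

Lemma reads_upper a b : reads (nseq a false) (two_bundles a b) 0.
Proof. by rewrite /reads drop0 prefix_prefix. Qed.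

Lemma reads_lower a b : reads (nseq b true) (two_bundles a b) a.
Proof. by rewrite /reads drop_size_cat ?size_nseq // prefix_refl. Qed.

#[local] Hint Resolve reads_upper reads_lower : core.

Lemma reads_upper_sub a b m j : (j + m <= a)%N ->
  reads (nseq m false) (two_bundles a b) j.
Proof. by move=> h; apply: (reads_sub (reads_upper a b)). Qed.

Lemma reads_lower_sub a b m j : (a <= j)%N -> (j + m <= a + b)%N ->
  reads (nseq m true) (two_bundles a b) j.
Proof. exact: (reads_sub (reads_lower a b)). Qed.

Lemma nseq_rcons (T : Type) n (x : T) t : nseq n x ++ x :: t = nseq n.+1 x ++ t.
Proof. by elim: n => //= n ->. Qed.

Lemma act_birth_bundles a b :
  act (two_bundles a b) (Birth false, a) = Some (two_bundles a.+1 b.+1).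
Proof.
rewrite /two_bundles -{2}(size_nseq a false) act_cat0 act_birth.
by congr Some; apply: nseq_rcons.
Qed.

Lemma act_death_bundles a b :
  act (two_bundles a.+1 b.+1) (Death, a) = Some (two_bundles a b).
Proof.
rewrite /two_bundles -nseq_rcons -{2}(size_nseq a false) act_cat0.
by rewrite -[nseq b.+1 _]/(true :: nseq b true) act_death.
Qed.

Lemma homs_birth a b :
  homs (two_bundles a b) (two_bundles a.+1 b.+1) (ev (Birth false) a).
Proof. exact/homs_ev/act_birth_bundles. Qed.

Lemma homs_death a b :
  homs (two_bundles a.+1 b.+1) (two_bundles a b) (ev Death a).
Proof. exact/homs_ev/act_death_bundles. Qed.

#[local] Instance gclasps_endo a b : endo (two_bundles a b) (gclasps a b).
Proof.
rewrite /endo /gclasps -lock; exact: homsM (clasp_rot_endo (reads_upper a b))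
  (clasp_endo (reads_lower a b)).
Qed.

Lemma twin_hw2 j : twin j j 2 (hw j) (hw j).
Proof. by have := @TwinH j j 2 0; rewrite addn0; apply. Qed.

Lemma gclasps_hw a b j : (j.+1 < a)%N || (a <= j)%N && (j.+1 < a + b)%N ->
  cong_at (two_bundles a b) (gclasps a b * hw j) 0.
Proof.
have e0 := clasp_rot_endo (reads_upper a b).
have e1 := clasp_endo (reads_lower a b).
rewrite /gclasps -!lock; case/orP => [ja|/andP [aj jb]].
  rewrite -mulrA -(twin_comm (twin_hw2 j) (twin_clasp a a b)); last by lia.
  rewrite mulrA (clasp_rotE (reads_upper a b)) (clasp_hw (reads_upper a b)) //.
  by rewrite mul0r; reflexivity.
by rewrite -mulrA (clasp_hw (reads_lower a b)) // mulr0; reflexivity.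
Qed.

Lemma hw_gclasps a b j : (j.+1 < a)%N || (a <= j)%N && (j.+1 < a + b)%N ->
  cong_at (two_bundles a b) (hw j * gclasps a b) 0.
Proof.
have e0 := clasp_rot_endo (reads_upper a b).
have e1 := clasp_endo (reads_lower a b).
rewrite /gclasps -!lock; case/orP => [ja|/andP [aj jb]]; rewrite mulrA.
  by rewrite (hw_clasp_rot (reads_upper a b)) // mul0r; reflexivity.
rewrite -(twin_hw (twin_clasp_rot 0 0 a)) // -mulrA (hw_clasp (reads_lower a
  b)) //.
by rewrite mulr0; reflexivity.
Qed.

Lemma gclasps_clasp0 a b p : (p <= a)%N ->
  cong_at (two_bundles a b) (gclasps a b * gclasp 0 p) (gclasps a b).
Proof. by move=> pa; apply: clasp_absorbr => j _ h; apply: gclasps_hw; lia. Qed.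

Lemma gclasps_rot a b j p : (a <= j)%N -> (j + p <= a + b)%N ->
  cong_at (two_bundles a b) (gclasps a b * gclasp_rot j p) (gclasps a b).
Proof. by move=> aj pb; apply: clasp_rot_absorbr => i h h'; apply: gclasps_hw;
  lia. Qed.

Lemma rot0_gclasps a b p : (p <= a)%N ->
  cong_at (two_bundles a b) (gclasp_rot 0 p * gclasps a b) (gclasps a b).
Proof.
move=> pa; apply: (clasp_rot_absorbl (reads_upper_sub b _)) => // j _ h.
by apply: hw_gclasps; lia.
Qed.

Lemma clasp_gclasps a b j p : (a <= j)%N -> (j + p <= a + b)%N ->
  cong_at (two_bundles a b) (gclasp j p * gclasps a b) (gclasps a b).
Proof.
move=> aj pb; apply: (clasp_absorbl (reads_lower_sub aj pb)) => i h h'.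
by apply: hw_gclasps; lia.
Qed.

(** Both clasps in the form whose recursion strips the strand next to the other bundle, where the
    arcs are attached. *)
Lemma gclaspsE a b :
  cong_at (two_bundles a b) (gclasps a b) (gclasp 0 a * gclasp_rot a b).
Proof.
have e0 := clasp_endo (reads_upper a b).
by rewrite /gclasps -!lock (clasp_rotE (reads_upper a b)) -(clasp_rotE
  (reads_lower a b)); reflexivity.
Qed.

Lemma gclasps_idem a b :
  cong_at (two_bundles a b) (gclasps a b * gclasps a b) (gclasps a b).
Proof.
have e0 := clasp_rot_endo (reads_upper a b).
by rewrite {1}/gclasps -lock -mulrA clasp_gclasps // rot0_gclasps //;
  reflexivity.
Qed.

Lemma birth_clasp0 a : cong (ev (Birth false) a * gclasp 0 a) (gclasp 0 a * ev
  (Birth false) a).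
Proof. by symmetry; apply: twin_below (twin_clasp 0 0 a) _. Qed.

Lemma death_clasp0 a : cong (gclasp 0 a * ev Death a) (ev Death a * gclasp 0 a).
Proof. by apply: twin_below (twin_clasp 0 0 a) _. Qed.

Lemma birth_lower d a n : cong (ev (Birth d) a * gclasp_rot a.+2 n) (gclasp_rot
  a n * ev (Birth d) a).
Proof.
apply: (@twin_above (Birth d) 0 n a) => /=; rewrite !addn0 addn2.
exact: twin_clasp_rot.
Qed.

Lemma death_lower a n : cong (gclasp_rot a.+2 n * ev Death a) (ev Death a *
  gclasp_rot a n).
Proof.
symmetry; apply: (@twin_above Death 0 n a) => /=; rewrite !addn0 addn2.
exact: twin_clasp_rot.
Qed.

(** * The bubble with one arc on the left *)

Section BaseBubble.
Variables a b : nat.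
Let u := two_bundles a b.
Let E := gclasps a b.
Let B := ev (Birth false) a.
Let D := ev Death a.
Let p := gclasp 0 a.
Let q := gclasp_rot a.+2 b.
Let q' := gclasp_rot a b.
Let h := hw a.-1.
Let h' := hw a.+1.

Let Bp : cong (B * p) (p * B). Proof. exact: birth_clasp0. Qed.
Let Bq : cong (B * q) (q' * B). Proof. exact: birth_lower. Qed.
Let pD : cong (p * D) (D * p). Proof. exact: death_clasp0. Qed.
Let qD : cong (q * D) (D * q'). Proof. exact: death_lower. Qed.
Let pq : cong (p * q) (q * p).
Proof. by apply: twin_comm (twin_clasp 0 0 a) (twin_clasp_rot a.+2 a.+2 b) _;
  lia. Qed.
Let ph' : cong (p * h') (h' * p).
Proof. by apply: twin_hw (twin_clasp 0 0 a) _; lia. Qed.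
Let hq : cong (h * q) (q * h).
Proof. by apply: twin_comm (twin_hw2 _) (twin_clasp_rot a.+2 a.+2 b) _;
  lia. Qed.
Let Ep : cong_at u (E * p) E. Proof. exact: gclasps_clasp0. Qed.
Let Eq : cong_at u (E * q') E. Proof. by apply: gclasps_rot; lia. Qed.
Let eE : endo u E. Proof. exact: gclasps_endo. Qed.
Let EE : cong_at u (p * q') E. Proof. by symmetry; apply: gclaspsE. Qed.

(** In this section [p] and [q] are the clasps left after stripping the strands [a] and [a.+1] of
    the inner arc, and [h], [h'] are the H's that touch these strands. Here neither H occurs: the
    clasps slide off the loop and [E] absorbs them. *)
Lemma base_loop : cong_at u (E * B * p * q * D) (qn 3 *: E).
Proof.
rewrite -!(mulrA E) Bp -!mulrA (mulrA B) Bq !mulrA Ep Eq -mulrA loop.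
  by rewrite -scalerAr mulr1; reflexivity.
by rewrite size_cat !size_nseq leq_addr.
Qed.

Lemma base_upper : (0 < a)%N -> cong_at u (E * B * (p * h * p) * q * D) (qn 2
  *: E).
Proof.
move=> a0; have hB : cong_at u (B * h * D) (qn 2 *: 1).
  have := @bubble_above false u a.-1; rewrite prednK //; apply.
  by apply: (@reads_upper_sub _ _ 1); lia.
transitivity (E * p * (B * h * D) * (p * q')).
  have -> : E * B * (p * h * p) * q * D = E * (B * p) * h * p * (q * D) by
    rewrite !mulrA.
  rewrite Bp qD; have -> : E * (p * B) * h * p * (D * q')
    = E * p * B * h * (p * D) * q'.
    by rewrite !mulrA.
  by rewrite pD !mulrA; reflexivity.
rewrite Ep hB -scalerAr mulr1 -scalerAl mulrA Ep Eq; reflexivity.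
Qed.

Lemma base_lower : (0 < b)%N -> cong_at u (E * B * p * (q * h' * q) * D) (qn 2
  *: E).
Proof.
move=> b0; have hB : cong_at u (B * h' * D) (qn 2 *: 1).
  by apply: bubble_below; apply: (@reads_lower_sub _ _ 1); lia.
transitivity (E * p * q' * (B * h' * D) * q').
  have -> : E * B * p * (q * h' * q) * D = E * (B * p) * q * h' * (q * D) by
    rewrite !mulrA.
  rewrite Bp qD; have -> : E * (p * B) * q * h' * (D * q')
    = E * p * (B * q) * h' * D * q'.
    by rewrite !mulrA.
  by rewrite Bq !mulrA; reflexivity.
rewrite Ep Eq hB -scalerAr mulr1 -scalerAl Eq; reflexivity.
Qed.

Lemma base_both : (0 < a)%N -> (0 < b)%N ->
  cong_at u (E * B * (p * h * p) * (q * h' * q) * D)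
    (E + E * (ev Death a.-1 * ev (Birth false) a.-1) * E).
Proof.
move=> a0 b0; have hB : cong_at u (B * (h * h') * D) (1
  + ev Death a.-1 * ev (Birth false) a.-1).
  have := @bubble_both false u a.-1; rewrite prednK //; apply.
  rewrite /reads /u /two_bundles -(prednK a0) -nseq_rcons drop_size_cat
    ?size_nseq //=.
  by rewrite -(prednK b0) /= prefix0s.
(* The clasps move away from the square. Those on its left vanish into [E]; those on its right
   recombine to a second [E], which must stay to the right of the turn-back term. *)
transitivity (E * p * q' * (B * (h * h') * D) * (p * q')).
  have -> : E * B * (p * h * p) * (q * h' * q) * D
    = E * (B * p) * h * (p * q) * h' * (q * D).
    by rewrite !mulrA.
  rewrite Bp pq qD.
  have -> : E * (p * B) * h * (q * p) * h' * (D * q')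
    = E * p * B * (h * q) * (p * h') * D * q'.
    by rewrite !mulrA.
  rewrite hq ph'.
  have -> : E * p * B * (q * h) * (h' * p) * D * q'
    = E * p * (B * q) * h * h' * (p * D) * q'.
    by rewrite !mulrA.
  by rewrite Bq pD !mulrA; reflexivity.
have hDB : endo u (ev Death a.-1 * ev (Birth false) a.-1).
  rewrite /u -(prednK a0) -(prednK b0); exact: homsM (homs_death _ _)
    (homs_birth _ _).
by rewrite Ep Eq hB mulrDr mulr1 mulrDl EE gclasps_idem; reflexivity.
Qed.

End BaseBubble.


(** Serves the degenerate sizes: a relation that needs [0 < a] is used only with a coefficient
    containing [a]. *)
Lemma cong_scale0 u c x y : (c != 0 -> cong_at u x y) ->
  cong_at u (c *: x) (c *: y).
Proof.
case: (eqVneq c 0) => [->|c0] h; first by rewrite !scale0r; reflexivity.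
by rewrite h //; reflexivity.
Qed.

Lemma bubble_base a b :
  cong_at (two_bundles a b)
    (gclasps a b * ev (Birth false) a * gclasps a.+1 b.+1 * ev Death a)
    ((qn (a + b).+3 / (qn a.+1 * qn b.+1)) *: gclasps a b
     + (qn a * qn b / (qn a.+1 * qn b.+1)) *:
       (gclasps a b * (ev Death a.-1 * ev (Birth false) a.-1) * gclasps a b)).
Proof.
set E := gclasps a b; set DB := ev Death _ * _; set u := two_bundles a b.
set c := qn a / qn a.+1; set c' := qn b / qn b.+1.
have hEB : homs u (two_bundles a.+1 b.+1) (E * ev (Birth false) a).
  exact: homsM (gclasps_endo a b) (homs_birth a b).
transitivity (E * ev (Birth false) a * (gclasp 0 a.+1 * gclasp_rot a.+1 b.+1) *
  ev Death a).
  by apply: (cong_mid _ hEB); apply: gclaspsE.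
have expand (G p X q Y D : A) : G * ((p - c *: X) * (q - c' *: Y)) * D
    = G * p * q * D - c *: (G * X * q * D) - c' *: (G * p * Y * D)
      + c' *: (c *: (G * X * Y * D)).
  rewrite !(mulrBr, mulrBl, =^~ scalerAr, =^~ scalerAl) !mulrA.
  by rewrite opprB addrA addrAC.
rewrite gclaspS gclasp_rotS add0n -/c -/c' expand.
have b1 := @base_loop a b; have b2 := @base_upper a b.
have b3 := @base_lower a b; have b4 := @base_both a b.
rewrite -/E -/u in b1 b2 b3 b4.
have c0 : c != 0 -> (0 < a)%N.
  by rewrite /c; case: (a) => //; rewrite qn0 mul0r eqxx.
have c0' : c' != 0 -> (0 < b)%N.
  by rewrite /c'; case: (b) => //; rewrite qn0 mul0r eqxx.
rewrite b1 (cong_scale0 (fun h => b2 (c0 h))) (cong_scale0 (fun h => b3 (c0'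
  h))).
rewrite (cong_scale0 (fun h' => cong_scale0 (fun h => b4 (c0 h) (c0' h')))).
rewrite -/DB !scalerDr !scalerA addrA -!scalerBl -scalerDl.
have qa := qn_neq0 a; have qb := qn_neq0 b.
have -> : qn 3 - c * qn 2 - c' * qn 2 + c' * c = qn (a
  + b).+3 / (qn a.+1 * qn b.+1).
  have -> : qn (a + b).+3 = qn (a.+1 + b.+1).+1 by congr qn; lia.
  rewrite qnD (qnSS 1) (qnSS a) (qnSS b) qn1 /c /c'.
  by field; rewrite qa qb.
have -> : c' * c = qn a * qn b / (qn a.+1 * qn b.+1).
  by rewrite /c /c'; field; rewrite qa qb.
by reflexivity.
Qed.

(** * Nested arcs and the clasps around them *)

Definition gopen (a k : nat) : A := dg [seq (Birth false,
  (a + j)%N) | j <- iota 0 k].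
Definition gclose (a k : nat) : A := dg [seq (Death,
  (a - j.+1)%N) | j <- iota 0 k].

Lemma dg_cons e d : dg (e :: d) = dg [:: e] * dg d.
Proof. exact: (dg_cat [:: e]). Qed.

Lemma gopen0 a : gopen a 0 = 1. Proof. exact: dg_nil. Qed.
Lemma gclose0 a : gclose a 0 = 1. Proof. exact: dg_nil. Qed.

Lemma gopenS a k : gopen a k.+1 = ev (Birth false) a * gopen a.+1 k.
Proof.
rewrite /gopen /= addn0 dg_cons; congr (_ * dg _).
rewrite (iotaDl 1 0) -map_comp; apply: eq_map => j /=; congr (_, _); lia.
Qed.

Lemma gcloseS a k : gclose a.+1 k.+1 = ev Death a * gclose a k.
Proof.
rewrite /gclose /= subn1 dg_cons; congr (_ * dg _).
by rewrite (iotaDl 1 0) -map_comp; apply: eq_map => j /=; rewrite subSS.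
Qed.

Lemma homs_gopen a b k : homs (two_bundles a b) (two_bundles (a + k) (b
  + k)) (gopen a k).
Proof.
elim: k a b => [|k IH] a b; first by rewrite gopen0 !addn0; apply: homs1.
by rewrite gopenS -!addSnnS; apply: homsM (homs_birth a b) (IH _ _).
Qed.

Lemma homs_gclose a b k : homs (two_bundles (a + k) (b
  + k)) (two_bundles a b) (gclose (a + k) k).
Proof.
elim: k => [|k IH]; first by rewrite gclose0 !addn0; apply: homs1.
by rewrite !addnS gcloseS; apply: homsM (homs_death _ _) IH.
Qed.

(** Smaller clasps may be inserted freely behind the innermost closing arc, since they slide back
    and are absorbed. This produces the left end required by the induction hypothesis of
    [bubble_arcs]. *)
Lemma gclasps_death a b : cong_at (two_bundles a.+1 b.+1)
  (gclasps a.+1 b.+1 * ev Death a * gclasps a b) (gclasps a.+1 b.+1 * ev Death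
    a).
Proof.
have eE := gclasps_endo a.+1 b.+1.
transitivity (gclasps a.+1 b.+1 * (ev Death a * (gclasp 0 a * gclasp_rot a b))).
  rewrite -mulrA; apply: cong_at_mull (gclasps_endo _ _) _.
  by apply: cong_at_mull (homs_death a b) _; apply: gclaspsE.
have -> : gclasps a.+1 b.+1 * (ev Death a * (gclasp 0 a * gclasp_rot a b))
  = gclasps a.+1 b.+1 * (ev Death a * gclasp 0 a) * gclasp_rot a b by rewrite
    !mulrA.
rewrite -(death_clasp0 a).
have -> : gclasps a.+1 b.+1 * (gclasp 0 a * ev Death a) * gclasp_rot a b
  = gclasps a.+1 b.+1 * gclasp 0 a * (ev Death a * gclasp_rot a b) by rewrite
    !mulrA.
rewrite -death_lower gclasps_clasp0 // mulrA gclasps_rot; [reflexivity|lia|lia].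
Qed.

(** The case k = 1, l = s+1 with n = a+1, m = b+1. After the innermost arc is closed by
    [bubble_base], its turn-back term contains the same configuration with one strand fewer in each
    bundle. If [s] equals [a] or [b], the last coefficient is 0 and the truncated position is
    harmless. *)
Lemma bubble_arcs s a b : (s <= a)%N -> (s <= b)%N ->
  cong_at (two_bundles a b)
    (gclasps a b * ev (Birth false) a * gclasps a.+1 b.+1 * gclose a.+1 s.+1)
    ((qn s.+1 * qn (a + b - s).+3 / (qn a.+1 * qn b.+1))
      *: (gclasps a b * gclose a s)
     + (qn (a - s) * qn (b - s) / (qn a.+1 * qn b.+1)) *:
       (gclasps a b * gclose a s.+1 * ev (Birth false) (a - s).-1 * gclasps (a
         - s) (b - s))).
Proof.
elim: s a b => [|s IH] a b sa sb.
  rewrite gcloseS gclose0 !mulr1 bubble_base !subn0 qn1 mul1r.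
  apply: cong_atD; first by reflexivity.
  case: a sa => [|a] sa; first by rewrite qn0 !mul0r !scale0r; reflexivity.
  by rewrite gcloseS gclose0 mulr1 !mulrA; reflexivity.
case: a b sa sb => [|a] [|b] // sa sb.
set E := gclasps a.+1 b.+1; set u := two_bundles _ _.
have hED : homs u (two_bundles a b) (E * ev Death a).
  exact: homsM (gclasps_endo _ _) (homs_death a b).
rewrite (gcloseS a.+1) mulrA bubble_base /= -/E !mulrDl -!scalerAl.
have ED : cong_at u (E * ev Death a * gclasps a b) (E * ev Death a) by exact:
  gclasps_death.
have -> : E * (ev Death a * ev (Birth false) a) * E * gclose a.+1 s.+1
   = E * ev Death a * (ev (Birth false) a * E * gclose a.+1 s.+1) by rewrite
     !mulrA.
rewrite -ED.
have -> : E * ev Death a * gclasps a b * (ev (Birth false) a * E * gclose a.+1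
  s.+1)
  = E * ev Death a * (gclasps a b * ev (Birth false) a * E * gclose a.+1 s.+1)
    by rewrite !mulrA.
rewrite (cong_at_mull hED (IH a b _ _)) //.
clearbody E.
rewrite mulrDr -!scalerAr !mulrA ED -!(mulrA _ (ev Death a)) -!gcloseS.
rewrite !subSS scalerDr !scalerA addrA -scalerDl.
have qa := qn_neq0 a; have qb := qn_neq0 b.
have qa1 := qn_neq0 a.+1; have qb1 := qn_neq0 b.+1.
have -> : qn (a.+1 + b.+1).+3 / (qn a.+2 * qn b.+2) +
    qn a.+1 * qn b.+1 / (qn a.+2 * qn b.+2) *
    (qn s.+1 * qn (a + b - s).+3 / (qn a.+1 * qn b.+1))
  = qn s.+2 * qn (a.+1 + b.+1 - s.+1).+3 / (qn a.+2 * qn b.+2).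
  have -> : (a.+1 + b.+1).+3 = (s.+1 + (a + b - s).+3).+1 by lia.
  have -> : (a.+1 + b.+1 - s.+1).+3 = (a + b - s).+4 by lia.
  (* [qnD] gives [a+b+5] = [s+2][a+b-s+4] - [s+1][a+b-s+3], and the subtracted product is what the
     induction hypothesis contributes. *)
  by rewrite qnD; field; rewrite qa qb qa1 qb1.
have -> : qn a.+1 * qn b.+1 / (qn a.+2 * qn b.+2) *
    (qn (a - s) * qn (b - s) / (qn a.+1 * qn b.+1))
  = qn (a - s) * qn (b - s) / (qn a.+2 * qn b.+2).
  by field; rewrite qa qb qa1 qb1.
by reflexivity.
Qed.

Lemma clasp0_gopen p a k : (p <= a)%N ->
  cong (gclasp_rot 0 p * gopen a k) (gopen a k * gclasp_rot 0 p).
Proof.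
elim: k a => [|k IH] a pa; first by rewrite gopen0 mulr1 mul1r; reflexivity.
rewrite gopenS mulrA (twin_below _ (twin_clasp_rot 0 0 p)) // -mulrA IH ?mulrA;
  last by lia.
by reflexivity.
Qed.

Lemma lower_gopen a n i k : (a <= i)%N ->
  cong (gclasp i n * gopen a k) (gopen a k * gclasp (i + k.*2) n).
Proof.
elim: k a i => [|k IH] a i ai; first by rewrite gopen0 mulr1 mul1r addn0;
  reflexivity.
rewrite gopenS mulrA -(@twin_above (Birth false) (i - a) n a (gclasp i.+2 n));
  last first.
  have -> : (a + arity_out (Birth false) + (i - a) = i.+2)%N by rewrite /=; lia.
  have -> : (a + arity_in (Birth false) + (i - a) = i)%N by rewrite /=; lia.
  exact: twin_clasp.
rewrite -mulrA IH ?mulrA; last by lia.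
by have -> : (i.+2 + k.*2 = i + k.+1.*2)%N by lia.
Qed.

(** The outer clasps slide along the arcs, the lower one gaining two strands above it for each arc,
    and disappear into the larger clasps. *)
Lemma gopen_gclasps a b k : cong_at (two_bundles a b)
  (gclasps a b * gopen a k * gclasps (a + k) (b + k))
  (gopen a k * gclasps (a + k) (b + k)).
Proof.
set v := two_bundles (a + k) (b + k).
transitivity (gopen a k * (gclasp_rot 0 a * (gclasp (a + k.*2) b * gclasps (a
  + k) (b + k)))).
  rewrite {1}/gclasps -lock -(mulrA _ (gclasp a b)) lower_gopen // !mulrA.
  by rewrite clasp0_gopen // ; reflexivity.
apply: cong_at_mull (homs_gopen a b k) _.
have e0 : endo v (gclasp_rot 0 a).
  by apply: clasp_rot_endo (reads_upper_sub _ _); lia.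
rewrite clasp_gclasps; [|lia|lia].
by rewrite rot0_gclasps; [reflexivity|lia].
Qed.

(** * Coefficients *)

Definition qfac (n : nat) : F := \prod_(1 <= i < n.+1) qn i.

Definition qbin (n k : nat) : F :=
  if (k <= n)%N then qfac n / (qfac k * qfac (n - k)) else 0.

Definition qcoef (n m k l t : nat) : F :=
  qbin n t * qbin m t * qbin t k * qbin t l
    * qbin (n + m - t + 2) (n + m - k - l + 2)
  / (qbin n k * qbin m k * qbin n l * qbin m l).

Lemma qfacS n : qfac n.+1 = qfac n * qn n.+1.
Proof. by rewrite /qfac big_nat_recr. Qed.

Lemma qfac_neq0 n : qfac n != 0.
Proof.
elim: n => [|n IH]; first by rewrite /qfac big_nil oner_eq0.
by rewrite qfacS mulf_neq0.
Qed.

Lemma qbin_neq0 n k : (k <= n)%N -> qbin n k != 0.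
Proof. by move=> kn; rewrite /qbin kn !mulf_neq0 ?invr_neq0 ?mulf_neq0
  ?qfac_neq0. Qed.

Lemma qbin_small n k : (n < k)%N -> qbin n k = 0.
Proof. by rewrite /qbin ltnNge => /negbTE ->. Qed.

Lemma qbinn n : qbin n n = 1.
Proof.
have q0 : qfac 0 = 1 by rewrite /qfac big_geq.
by rewrite /qbin leqnn subnn q0 mulr1 divff ?qfac_neq0.
Qed.

Lemma qbinSr n k : qbin n k.+1 * qn k.+1 = qbin n k * qn (n - k).
Proof.
case: (ltngtP n k) => [nk|kn|->].
- by rewrite !qbin_small ?mul0r //; lia.
- rewrite /qbin kn ltnW //; have -> : (n - k = (n - k.+1).+1)%N by lia.
  rewrite !qfacS; have := qfac_neq0 k; have := qfac_neq0 (n - k.+1).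
  have := qn_neq0 k; have := qn_neq0 (n - k.+1) => h1 h2 h3 h4.
  by field; rewrite h1 h2 h3 h4.
- by rewrite qbin_small // subnn qn0 mul0r mulr0.
Qed.

Lemma qbinSS n k : qbin n.+1 k.+1 * qn k.+1 = qbin n k * qn n.+1.
Proof.
case: (leqP k n) => kn; last by rewrite !qbin_small ?mul0r.
rewrite /qbin ltnS kn subSS !qfacS; have := qfac_neq0 k; have :=
  qfac_neq0 (n - k).
have := qn_neq0 k => h1 h2 h3.
by field; rewrite h1 h2 h3.
Qed.

Lemma qbinSl n k : qbin n k * qn n.+1 = qbin n.+1 k * qn (n.+1 - k).
Proof.
case: (ltngtP n.+1 k) => [nk|kn|<-].
- by rewrite !qbin_small ?mul0r //; lia.
- have kn' : (k <= n)%N by lia.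
  rewrite /qbin kn' ltnW // subSn // !qfacS; have := qfac_neq0 k; have :=
    qfac_neq0 (n - k).
  have := qn_neq0 (n - k) => h1 h2 h3.
  by field; rewrite h1 h2 h3.
- by rewrite qbin_small // subnn qn0 mul0r mulr0.
Qed.

(** [coefA] and [coefB] are the coefficients of [bubble_arcs] for a = n-k-1, b = m-k-1, s =
    t-k-1. *)
Definition coefA (n m k t : nat) : F :=
  qn (t - k) * qn (n + m - k - t + 2) / (qn (n - k) * qn (m - k)).
Definition coefB (n m k t : nat) : F :=
  qn (n - t) * qn (m - t) / (qn (n - k) * qn (m - k)).

(** Lets the sums run over all t up to [minn n m], so that the induction on k need not track the
    range. The bound on t in the last case keeps the truncated subtractions exact. *)
Lemma qcoef_small n m k l t : (t < k)%N || (t < l)%N || (k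
  + l < t <= minn n m)%N ->
  qcoef n m k l t = 0.
Proof.
rewrite /qcoef => /orP [/orP [h|h]|h].
- by rewrite (qbin_small h) !(mul0r, mulr0).
- by rewrite (qbin_small h) !(mul0r, mulr0).
- by rewrite (@qbin_small (_ + 2)) ?(mul0r, mulr0) //; lia.
Qed.

(** A Pascal-type rule: R(t) at level k+1 comes from R(t) by [coefA] and from R(t-1) by [coefB]. *)
Lemma qcoefS n m k l t : (k < minn n m)%N -> (l <= minn n m)%N ->
  (t <= minn n m)%N ->
  qcoef n m k.+1 l t = qcoef n m k l t * coefA n m k t
    + (if t is t'.+1 then qcoef n m k l t' * coefB n m k t' else 0).
Proof.
rewrite ltn_min !leq_min => /andP [kn km] /andP [ln lm].
case: t => [|t] /andP [tn tm].
  by rewrite qcoef_small // /coefA sub0n qn0 !(mul0r, mulr0) addr0.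
(* At [t.+1 = k] the coefficient [qcoef n m k l t.+1] may be nonzero; it is the factor [0] in
   [coefA] that vanishes. *)
case: (leqP t.+1 k) => tk.
  rewrite qcoef_small ?(@qcoef_small _ _ k l t) ?ltnS ?tk ?(leqW tk) //.
  by rewrite /coefA (eqP (tk : t.+1 - k == 0)%N) qn0 !(mul0r, mulr0) addr0.
case: (ltnP t.+1 l) => tl.
  by rewrite !qcoef_small ?tl ?(ltnW tl) ?orbT // !mul0r addr0.
case: (ltnP (k + l).+1 t.+1) => tkl.
  by rewrite !qcoef_small ?mul0r ?addr0 //; apply/orP; right; rewrite leq_min;
    lia.
pose X := (n + m - t.+1 + 2)%N; pose Y := (n + m - k - l + 1)%N.
pose d := (t.+1 - l)%N; pose e := (k + l - t)%N.
(* The product identity with [f = X - k]; the sums collapse because t+1 >= l and t <= k+l in this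
   branch. *)
have J : qn k.+1 * qn Y.+1 = qn e * qn (X - k) + qn d * qn X.+1.
  have -> : k.+1 = (d + e)%N by lia.
  have -> : Y.+1 = (d + (X - k))%N by lia.
  rewrite qnJ; congr (_ + _ * qn _); lia.
have -> : qcoef n m k.+1 l t.+1 =
  qbin n t.+1 * qbin m t.+1 * qbin t.+1 k.+1 * qbin t.+1 l * qbin X Y
  / (qbin n k.+1 * qbin m k.+1 * qbin n l * qbin m l).
  by rewrite /qcoef; congr (_ * qbin _ _ / _); lia.
have -> : qcoef n m k l t.+1 =
  qbin n t.+1 * qbin m t.+1 * qbin t.+1 k * qbin t.+1 l * qbin X Y.+1
  / (qbin n k * qbin m k * qbin n l * qbin m l).
  by rewrite /qcoef; congr (_ * qbin _ _ / _); lia.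
have -> : qcoef n m k l t =
  qbin n t * qbin m t * qbin t k * qbin t l * qbin X.+1 Y.+1
  / (qbin n k * qbin m k * qbin n l * qbin m l).
  by rewrite /qcoef; congr (_ * qbin _ _ / _); lia.
rewrite /coefA /coefB.
have -> : (n + m - k - t.+1 + 2 = X - k)%N by lia.
have nz i : (0 < i)%N -> qn i != 0 by case: i.
have nt : qn (n - t) != 0 by apply: nz; lia.
have mt : qn (m - t) != 0 by apply: nz; lia.
have nk : qn (n - k) != 0 by apply: nz; lia.
have mk : qn (m - k) != 0 by apply: nz; lia.
have k1 := qn_neq0 k; have t1 := qn_neq0 t; have y1 := qn_neq0 Y.
have nk' := qbin_neq0 (ltnW kn); have mk' := qbin_neq0 (ltnW km).
have nl' := qbin_neq0 ln; have ml' := qbin_neq0 lm.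
have -> : qbin n t = qbin n t.+1 * qn t.+1 / qn (n - t) by rewrite qbinSr mulfK.
have -> : qbin m t = qbin m t.+1 * qn t.+1 / qn (m - t) by rewrite qbinSr mulfK.
have -> : qbin t k = qbin t.+1 k * qn (t.+1 - k) / qn t.+1 by rewrite -qbinSl
  mulfK.
have -> : qbin t l = qbin t.+1 l * qn d / qn t.+1 by rewrite -qbinSl mulfK.
have -> : qbin t.+1 k.+1 = qbin t.+1 k * qn (t.+1 - k) / qn k.+1 by rewrite
  -qbinSr mulfK.
have -> : qbin n k.+1 = qbin n k * qn (n - k) / qn k.+1 by rewrite -qbinSr
  mulfK.
have -> : qbin m k.+1 = qbin m k * qn (m - k) / qn k.+1 by rewrite -qbinSr
  mulfK.
have -> : qbin X Y.+1 = qbin X Y * qn e / qn Y.+1.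
  have -> : e = (X - Y)%N by rewrite /e /X /Y;
    clear -kn km ln lm tn tm tk tl tkl; lia.
  by rewrite -qbinSr mulfK.
have -> : qbin X.+1 Y.+1 = qbin X Y * qn X.+1 / qn Y.+1 by rewrite -qbinSS
  mulfK.
(* [G] is the common factor of the three coefficients, all expressed through the same binomials;
   what remains is [J]. *)
pose G := qbin n t.+1 * qbin m t.+1 * qbin t.+1 k * qbin t.+1 l * qbin X Y * qn
  (t.+1 - k)
  / (qbin n k * qbin m k * qbin n l * qbin m l * qn (n - k) * qn (m - k) * qn
    Y.+1).
transitivity (G * (qn k.+1 * qn Y.+1)).
  by rewrite /G; field; rewrite nk mk k1 y1 nk' mk' nl' ml'.
rewrite J mulrDr; congr (_ + _).
  by rewrite /G; field; rewrite nk mk y1 nk' mk' nl' ml'.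
by rewrite /G; field; rewrite nk mk y1 nk' mk' nl' ml' nt mt t1.
Qed.

(** * The expansion of the bubble *)

Definition gbubble (n m k l : nat) : A :=
  gclasps (n - k) (m - k) * gopen (n - k) k * gclasps n m * gclose n l
    * gclasps (n - l) (m - l).

Definition grung (n m k l t : nat) : A :=
  gclasps (n - k) (m - k) * gclose (n - k) (t - k) * gopen (n - t) (t - l)
    * gclasps (n - l) (m - l).

(** The new arc on the left, the clasps behind it and the t-k closing arcs form the bubble of
    [bubble_arcs]; its two terms are R(t) and R(t+1). *)
Lemma grung_step n m k l t : (k < minn n m)%N ->
  (maxn k l <= t <= minn n m)%N ->
  cong_at (two_bundles (n - k.+1) (m - k.+1))
    (gclasps (n - k.+1) (m - k.+1) * ev (Birth false) (n - k.+1) * grung n m k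
      l t)
    (coefA n m k t *: grung n m k.+1 l t + coefB n m k t
      *: grung n m k.+1 l t.+1).
Proof.
rewrite leq_min geq_max leq_min => /andP [kn km] /andP [/andP [kt lt] /andP [tn
  tm]].
rewrite /grung /coefA /coefB.
have [a ea] : exists a, a = (n - k.+1)%N by eexists.
have [b eb] : exists b, b = (m - k.+1)%N by eexists.
have -> : (n - k = a.+1)%N by lia.
have -> : (m - k = b.+1)%N by lia.
rewrite -ea -eb; set T := gclasps (n - l) (m - l).
(* For t = k no arc closes the bubble: the new arc merely joins the opening arcs, in agreement with
   [coefA] = 0 and [coefB] = 1. *)
case: (posnP (t - k)) => [tk|tk0].
  have -> : t = k by lia.
  rewrite subnn qn0 mul0r mul0r scale0r add0r gclose0 mulr1 subSS subnn gclose0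
    mulr1.
  have -> : (n - k = a.+1)%N by lia.
  have -> : (m - k = b.+1)%N by lia.
  have -> : (k.+1 - l = (k - l).+1)%N by lia.
  rewrite divff ?mulf_neq0 ?qn_neq0 // scale1r -ea gopenS -!mulrA.
  apply: cong_at_mull (gclasps_endo a b) _;
    apply: cong_at_mull (homs_birth a b) _.
  rewrite mulrA; have := @gopen_gclasps a.+1 b.+1 (k - l).
  have -> : (a.+1 + (k - l) = n - l)%N by lia.
  by have -> : (b.+1 + (k - l) = m - l)%N by lia.
pose s := (t - k).-1.
have es : (t - k = s.+1)%N by rewrite prednK.
have -> : (t - k.+1 = s)%N by lia.
have -> : (t.+1 - k.+1 = s.+1)%N by lia.
have -> : (n + m - k - t + 2 = (a + b - s).+3)%N by lia.
have -> : (n - t = a - s)%N by lia.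
have -> : (m - t = b - s)%N by lia.
have -> : (t.+1 - l = (t - l).+1)%N by lia.
have -> : (n - t.+1 = (a - s).-1)%N by lia.
rewrite es !mulrA (@bubble_arcs s a b) ?mulrDl -?scalerAl; [|lia|lia].
apply: cong_atD; first by reflexivity.
(* A nonzero coefficient ensures t < n and t < m, so a further arc can be closed and reopened. *)
apply: cong_scale0 => nz.
have as0 : (0 < a - s)%N.
  by rewrite lt0n; apply: contraNneq nz => ->; rewrite qn0 !mul0r.
have bs0 : (0 < b - s)%N.
  by rewrite lt0n; apply: contraNneq nz => ->; rewrite qn0 mulr0 mul0r.
rewrite gopenS prednK // -!mulrA.
apply: cong_at_mull (gclasps_endo a b) _.
have hD : homs (two_bundles a b) (two_bundles (a - s).-1 (b - s).-1) (gclose a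
  s.+1).
  have := homs_gclose (a - s).-1 (b - s).-1 s.+1.
  have -> : ((a - s).-1 + s.+1 = a)%N by lia.
  by have -> : ((b - s).-1 + s.+1 = b)%N by lia.
apply: (cong_at_mull hD).
have hB := homs_birth (a - s).-1 (b - s).-1; rewrite !prednK // in hB.
apply: (cong_at_mull hB); rewrite mulrA.
have := @gopen_gclasps (a - s) (b - s) (t - l).
have -> : (a - s + (t - l) = n - l)%N by lia.
by have -> : (b - s + (t - l) = m - l)%N by lia.
Qed.

Lemma cong_at_sum (I : Type) (r : seq I) (P : pred I) (f g : I -> A) u :
  (forall i, P i -> cong_at u (f i) (g i)) ->
  cong_at u (\sum_(i <- r | P i) f i) (\sum_(i <- r | P i) g i).
Proof.
move=> h; elim/big_rec2: _ => [|i x y Pi hxy]; first by reflexivity.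
by rewrite (h i Pi) hxy; reflexivity.
Qed.

(** The outermost opening arc is split off; the clasps that [gbubble n m k l] has before its arcs
    are absorbed by the middle ones. *)
Lemma gbubble_step n m k l : (k < minn n m)%N ->
  cong_at (two_bundles (n - k.+1) (m - k.+1)) (gbubble n m k.+1 l)
    (gclasps (n - k.+1) (m - k.+1) * ev (Birth false) (n - k.+1) * gbubble n m
      k l).
Proof.
rewrite leq_min => /andP [kn km]; rewrite /gbubble gopenS.
have -> : (n - k.+1).+1 = (n - k)%N by lia.
rewrite !mulrA; do 2 apply: cong_at_mulr => //.
rewrite -!mulrA; apply: cong_at_mull (gclasps_endo _ _) _.
have hB := homs_birth (n - k.+1) (m - k.+1).
have en : (n - k.+1).+1 = (n - k)%N by lia.
have em : (m - k.+1).+1 = (m - k)%N by lia.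
rewrite en em in hB; apply: (cong_at_mull hB); symmetry; rewrite mulrA.
have := @gopen_gclasps (n - k) (m - k) k.
by rewrite !subnK // ltnW.
Qed.

Lemma gbubbleE n m k l : (k <= minn n m)%N -> (l <= minn n m)%N ->
  cong_at (two_bundles (n - k) (m - k)) (gbubble n m k l)
    (\sum_(0 <= t < (minn n m).+1) qcoef n m k l t *: grung n m k l t).
Proof.
move=> kN lN; elim: k kN => [|k IH] kN.
  (* For k = 0 only t = l survives, with coefficient 1, and the bubble is R(l) up to merging two
     adjacent clasps. *)
  rewrite (bigD1_seq l) ?mem_index_iota ?iota_uniq //= big1_seq ?addr0;
    last first.
    move=> t /andP [tl]; rewrite mem_index_iota => /andP [_ tN].
    by rewrite qcoef_small ?scale0r //; lia.
  move: lN; rewrite leq_min => /andP [ln lm].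
  have -> : qcoef n m 0 l l = 1.
    rewrite /qcoef subn0.
    have q0 i : qbin i 0 = 1.
      rewrite /qbin leq0n subn0; have -> : qfac 0 = 1 by rewrite /qfac big_geq.
      by rewrite mul1r divff ?qfac_neq0.
    rewrite !q0 !qbinn !mulr1 !mul1r divff //.
    by rewrite mulf_neq0 ?qbin_neq0.
  rewrite scale1r /gbubble /grung !subn0 subnn !gopen0 !mulr1 gclasps_idem.
  by reflexivity.
have hTB : homs (two_bundles (n - k.+1) (m - k.+1)) (two_bundles (n - k) (m -
  k))
    (gclasps (n - k.+1) (m - k.+1) * ev (Birth false) (n - k.+1)).
  have := homsM (gclasps_endo _ _) (homs_birth (n - k.+1) (m - k.+1)).
  have -> : (n - k.+1).+1 = (n - k)%N by lia.
  by have -> : (m - k.+1).+1 = (m - k)%N by lia.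
rewrite gbubble_step // (cong_at_mull hTB (IH (ltnW kN))) mulr_sumr.
transitivity (\sum_(0 <= t < (minn n m).+1) (
    (qcoef n m k l t * coefA n m k t) *: grung n m k.+1 l t
    + (qcoef n m k l t * coefB n m k t) *: grung n m k.+1 l t.+1)).
  rewrite [X in cong_at _ X _]big_nat_cond [X in cong_at _ _ X]big_nat_cond.
  apply: cong_at_sum => t /andP [/andP [_ tN] _].
  rewrite -scalerAr; case: (leqP (maxn k l) t) => klt.
    rewrite grung_step ?klt // scalerDr !scalerA.
    by reflexivity.
  rewrite qcoef_small; last by lia.
  by rewrite !mul0r !scale0r addr0; reflexivity.
rewrite big_split /= [X in _ + X]big_nat_recr //= [X in cong_at _ (X
  + _) _]big_nat_recl //.
(* For N = [minn n m], one of n-N and m-N is 0, so no R(N+1) appears. *)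
have BN : qcoef n m k l (minn n m) * coefB n m k (minn n m) = 0.
  by rewrite /coefB; case: (leqP n m) => _; rewrite subnn qn0 !(mul0r, mulr0).
rewrite BN scale0r addr0 [X in cong_at _ _ X]big_nat_recl //.
rewrite -addrA -big_split /= qcoefS // addr0.
rewrite [X in cong_at _ (_ + X) _]big_nat_cond [X in cong_at _ _ (_
  + X)]big_nat_cond.
apply: cong_atD; first by reflexivity.
apply: cong_at_sum => t /andP [/andP [_ tN] _].
by rewrite qcoefS // scalerDl; reflexivity.
Qed.

Lemma homs_gbubble n m k l : (k <= minn n m)%N -> (l <= minn n m)%N ->
  homs (two_bundles (n - k) (m - k)) (two_bundles (n - l) (m - l)) (gbubble n m
    k l).
Proof.
rewrite !leq_min => /andP [kn km] /andP [ln lm].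
have ho := homs_gopen (n - k) (m - k) k; rewrite !subnK // in ho.
have hc := homs_gclose (n - l) (m - l) l; rewrite !subnK // in hc.
by do ![apply: homsM; last by [apply: gclasps_endo | exact: hc | exact: ho]];
  apply: gclasps_endo.
Qed.

Lemma homs_grung n m k l t : (maxn k l <= t <= minn n m)%N ->
  homs (two_bundles (n - k) (m - k)) (two_bundles (n - l) (m - l)) (grung n m k
    l t).
Proof.
rewrite geq_max leq_min => /andP [/andP [kt lt] /andP [tn tm]].
have ho := homs_gopen (n - t) (m - t) (t - l).
have hc := homs_gclose (n - t) (m - t) (t - k).
have E a b c : (a <= b)%N -> (b <= c)%N -> (c - b + (b - a) = c - a)%N by lia.
rewrite !E // in ho hc.
by do ![apply: homsM; last by [apply: gclasps_endo | exact: hc | exact: ho]];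
  apply: gclasps_endo.
Qed.

Lemma bubble_expansion n m k l : (k <= minn n m)%N -> (l <= minn n m)%N ->
  w = two_bundles (n - k) (m - k) ->
  phi (gbubble n m k l) = \sum_(maxn k l <= t < (minn (k + l) (minn n m)).+1)
    qcoef n m k l t *: phi (grung n m k l t).
Proof.
(* The empty sequence on the left and 1 on the right turn the congruence into an equality of
   images. *)
move=> kN lN ew; have := @gbubbleE n m k l kN lN [::] 1.
rewrite dg_nil !mul1r !mulr1 ew => -> //.
rewrite (@big_cat_nat _ _ _ (maxn k l)) /=; [|by []|lia].
rewrite big_nat_cond big1 ?add0r; last first.
  by move=> t /andP [/andP [_ h] _]; rewrite qcoef_small ?scale0r //; lia.
rewrite (@big_cat_nat _ _ _ (minn (k + l) (minn n m)).+1) /=; [|lia|lia].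
rewrite [X in _ + X]big_nat_cond [X in _ + X]big1 ?addr0; last first.
  by move=> t /andP [/andP [h h'] _]; rewrite qcoef_small ?scale0r //; lia.
by rewrite linear_sum; apply: eq_bigr => t _; rewrite linearZ.
Qed.

End Skein.

(** * The web space *)

Lemma diag_cat d e : diag (d ++ e) = diag d * diag e.
Proof.
rewrite /diag malgM_def fgmulUU mulr1; congr (mkmalgU _ _).
by rewrite -[RHS]/(fmmul _ _) fmmulE.
Qed.

Lemma diag_nil : diag [::] = 1.
Proof. by rewrite /diag -fmoneE. Qed.

Lemma malgU_diag (c : K) (k : {fmonom event}) : << c *g k >> = c *: diag k.
Proof.
apply/malgP=> j; rewrite mcoeffZ /diag fmK !mcoeffU.
by case: eqP; rewrite ?mulr1 ?mulr0.
Qed.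

Lemma diagrams_ind (P : diagrams -> Prop) :
  P 0 -> (forall x y, P x -> P y -> P (x + y)) ->
  (forall c x, P x -> P (c *: x)) -> (forall d, P (diag d)) ->
  forall x, P x.
Proof.
move=> P0 PD PZ Pd x; rewrite [x]monalgE.
by elim/big_ind: _ => // k _; rewrite malgU_diag; apply: PZ.
Qed.

(** Scalars are central, which makes [diagrams] an [algType] to which the abstract section
    applies. *)
Lemma diagrams_scalerAr (c : K) (x y : diagrams) : c *: (x * y) = x * (c *: y).
Proof.
have cC : x * c%:MP = c *: x.
  rewrite malgM_def fgmulgU malgZ_def; apply: eq_bigr => k _.
  by rewrite mulm1 mulrC.
by rewrite -[in RHS]mul_malgC mulrA cC scalerAl.
Qed.

HB.instance Definition _ := GRing.Lalgebra.on diagrams.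
HB.instance Definition _ :=
  GRing.Lalgebra_isAlgebra.Build K diagrams diagrams_scalerAr.

Section WebBracket.
Variables (w w' : word) (br : {linear diagrams -> web_space w w'}).

(** The extension of [br] by zero off webs, defined on the monomial basis because [br] is
    unconstrained there. *)
Definition webbr (x : diagrams) : web_space w w' :=
  \sum_(k <- msupp x) x@_k *: (if is_web w w' k then br (diag k) else 0).

(** A larger index set gives the same sum; linearity is proved over one set containing all supports
    involved. *)
Lemma webbrEw (D : {fset {fmonom event}}) x : (msupp x `<=` D)%fset ->
  webbr x = \sum_(k <- D) x@_k *: (if is_web w w' k then br (diag k) else 0).
Proof.
move=> sD; apply: big_fset_incl => // k _ /mcoeff_outdom ->.
by rewrite scale0r.
Qed.

Lemma webbr_linear : linear webbr.
Proof.
move=> c x y; pose D := (msupp x `|` msupp y `|` msupp (c *: x + y))%fset.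
have sD z : z \in [:: x; y; c *: x + y] -> (msupp z `<=` D)%fset.
  rewrite !inE => h; apply/fsubsetP=> k hk.
  by rewrite !inE; case/or3P: h hk => /eqP -> ->; rewrite ?orbT.
rewrite !(@webbrEw D) ?sD ?inE ?eqxx ?orbT //.
rewrite scaler_sumr -big_split /=; apply: eq_bigr => k _.
by rewrite mcoeffD mcoeffZ scalerDl scalerA.
Qed.

HB.instance Definition _ :=
  GRing.isLinear.Build K diagrams (web_space w w') _ webbr webbr_linear.

Lemma webbr_diag d : webbr (diag d) = if is_web w w' d then br (diag d) else 0.
Proof.
rewrite (@webbrEw [fset FMonom d]%fset) ?msuppU_le // big_seq_fset1.
by rewrite mcoeffUU scale1r.
Qed.

Lemma webbr_web d : run w d = Some w' -> webbr (diag d) = br (diag d).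
Proof. by move=> h; rewrite webbr_diag /is_web h eqxx. Qed.

Lemma webbr_homs x : homs diag w w' x -> webbr x = br x.
Proof.
elim=> {x} [d hd||x y _ IHx _ IHy|c x _ IH]; first exact: webbr_web.
- by rewrite !linear0.
- by rewrite !linearD /= IHx IHy.
- by rewrite !linearZ /= IH.
Qed.

End WebBracket.

(** * Quantum integers at a parameter that is not a root of unity *)

Lemma tofracX_neq0 : FracField.tofrac ('X : {poly rat}) != 0 :> K.
Proof. by rewrite tofrac_eq0 polyX_eq0. Qed.

Lemma q_half_neq0 : q_half != 0.
Proof. exact: expf_neq0 tofracX_neq0. Qed.

Lemma q_half_pow_neq1 n : q_half ^+ n.+1 != 1.
Proof.
rewrite /q_half -exprM -tofracXn -tofrac1 tofrac_eq.
apply/eqP => /(congr1 (fun p : {poly rat} => size p)).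
by rewrite size_polyXn size_poly1 mulnS.
Qed.

Section QuantumIntegers.

Variables (F : fieldType) (h : F).
Hypotheses (h0 : h != 0) (h1 : forall n, h ^+ n.+1 != 1).

Let q (k : nat) : F := (h ^+ k - h ^- k) / (h - h^-1).

(** Equality of the (n+1)-st power of [h] with its inverse would make the (2n+2)-nd power equal to
    1. *)
Lemma expfB_neq0 n : h ^+ n.+1 - h ^- n.+1 != 0.
Proof.
rewrite subr_eq0; apply: contra_neq (h1 (n + n.+1)) => e.
by rewrite -addSn exprD {1}e mulVf // expf_neq0.
Qed.

Lemma qinteger_neq0 n : q n.+1 != 0.
Proof. exact: mulf_neq0 (expfB_neq0 n) (invr_neq0 (expfB_neq0 0)). Qed.

Lemma qinteger1 : q 1 = 1.
Proof. exact: divff (expfB_neq0 0). Qed.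

Lemma qintegerM d e f : q (d + e) * q (d + f) = q e * q f + q d * q (d + e + f).
Proof.
rewrite /q !exprD.
have := expf_neq0 d h0; have := expf_neq0 e h0; have := expf_neq0 f h0.
have : h - h^-1 != 0 by exact: expfB_neq0 0.
move: (h ^+ d) (h ^+ e) (h ^+ f) (h - h^-1) => x y z t ht hz hy hx.
by field; rewrite hx hy hz ht.
Qed.

End QuantumIntegers.

Lemma qint0 : qint 0 = 0.
Proof. by rewrite /qint expr0 invr1 subrr mul0r. Qed.

Lemma claspE i n : clasp i n = gclasp diag qint i n.
Proof. by elim: n => [|[|n] IH] //; rewrite gclaspSS -IH. Qed.

Lemma clasp_rotgE i n : clasp_rot i n = gclasp_rot diag qint i n.
Proof. by elim: n i => [|[|n] IH] i //; rewrite gclasp_rotSS -IH. Qed.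

Lemma two_claspsE a b : two_clasps a b = gclasps diag qint a b.
Proof. by rewrite /two_clasps /gclasps -lock claspE clasp_rotgE. Qed.

Lemma bubbleE n m k l : bubble n m k l = gbubble diag qint n m k l.
Proof. by rewrite /bubble !two_claspsE. Qed.

Lemma rungE n m k l t : rung n m k l t = grung diag qint n m k l t.
Proof. by rewrite /rung !two_claspsE. Qed.

Theorem theorem4p2 (n m k l : nat)
  (hn : (0 < n)%N) (hm : (0 < m)%N)
  (hk : (k <= minn n m)%N) (hl : (l <= minn n m)%N)
  (br : {linear diagrams ->
           web_space (two_bundles (n - k) (m - k)) (two_bundles (n - l) (m - l))})
  (hbr : is_A2_bracket br) :
  br (bubble n m k l)
  = \sum_(maxn k l <= t < (minn (k + l) (minn n m)).+1)
      bubble_coef n m k l t *: br (rung n m k l t).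
Proof.
set w := two_bundles (n - k) (m - k); set w' := two_bundles (n - l) (m - l).
have web x y (z : word) d : run x d = Some y -> is_web x y d.
  by move=> h; rewrite /is_web h.
have cat3 u v p d s : run w p = Some u -> run u d = Some v ->
  run v s = Some w' ->
    run w (p ++ d ++ s) = Some w'.
  by move=> hp hd hs; rewrite run_cat hp /= run_cat hd.
have cat2 u p s : run w p = Some u -> run u s = Some w' ->
  run w (p ++ s) = Some w'.
  by move=> hp hs; rewrite run_cat hp.
have [move_ _ loop_ bigon_ square_] := hbr.
have bad d : run w d <> Some w' -> webbr br (diag d) = 0.
  by move=> hd; rewrite webbr_diag /is_web; case: eqP.
have moves u v p a b s : isotopy_move a b -> run w p = Some u ->
    run u a = Some v -> run u b = Some v -> run v s = Some w' ->
    webbr br (diag (p ++ a ++ s)) = webbr br (diag (p ++ b ++ s)).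
  move=> hab hp ha hb hs; rewrite !webbr_web ?(cat3 u v) //.
  by apply: move_; apply: (IsotopyStep hab); apply: web; eassumption.
have loops u p s d i : run w p = Some u -> run u s = Some w' ->
    run u [:: (Birth d, i); (Death, i)] = Some u ->
    webbr br (diag (p ++ [:: (Birth d, i); (Death, i)] ++ s))
    = qint 3 *: webbr br (diag (p ++ s)).
  move=> hp hs hd; rewrite !webbr_web ?(cat3 u u) ?(cat2 u) //.
  by apply: loop_; apply: web; eassumption.
have bigons u p s i : run w p = Some u -> run u s = Some w' ->
    run u [:: (Fork, i); (Fuse, i)] = Some u ->
    webbr br (diag (p ++ [:: (Fork, i); (Fuse, i)] ++ s))
    = qint 2 *: webbr br (diag (p ++ s)).
  move=> hp hs hd; rewrite !webbr_web ?(cat3 u u) ?(cat2 u) //.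
  by apply: bigon_; apply: web; eassumption.
have squares u p s d i : run w p = Some u -> run u s = Some w' ->
    run u [:: (Fork, i); (Fuse, i.+1); (Fork, i); (Fuse, i.+1)] = Some u ->
    run u [:: (Death, i); (Birth d, i)] = Some u ->
    webbr br (diag (p ++ [:: (Fork, i); (Fuse, i.+1); (Fork, i); (Fuse,
      i.+1)] ++ s))
    = webbr br (diag (p ++ s))
      + webbr br (diag (p ++ [:: (Death, i); (Birth d, i)] ++ s)).
  move=> hp hs hd hd'; rewrite !webbr_web ?(cat3 u u) ?(cat2 u) //.
  by apply: square_; apply: web; eassumption.
rewrite bubbleE; apply: etrans (esym (webbr_homs br (homs_gbubble diag_nil
  diag_cat qint hk hl))) _.
have H := (bubble_expansion diag_nil diag_cat diagrams_ind bad moves loops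
  bigons
  squares qint0 (qinteger1 q_half_neq0 q_half_pow_neq1) (qinteger_neq0
    q_half_neq0 q_half_pow_neq1)
  (qintegerM q_half_neq0 q_half_pow_neq1) hk hl erefl).
apply: (etrans H).
(* The coefficients agree by conversion. The range of t makes [rung] a combination of webs, so that
   [webbr] may be turned back into [br]. *)
apply: eq_big_nat => t /andP [lt_t t_lt].
have ht : (maxn k l <= t <= minn n m)%N.
  by rewrite lt_t (leq_trans (t_lt : (t <= minn (k
    + l) (minn n m))%N)) ?geq_minr.
rewrite rungE; congr (_ *: _).
exact: webbr_homs (homs_grung diag_nil diag_cat qint ht).
Qed.
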